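(* Let $A\in\mathbb{R}^{n\times n}$ be orthogonal, $S_{n,k}=\{x\in\mathbb{R}^n:\|x\|_2=1,\ \|x\|_0\le k\}$ (where $\|x\|_0$ is the number of nonzero entries), and $T=A(S_{n,k})$. Let $\varepsilon\in(0,1/2)$, $\eta\le 1/m$, and let $\Phi\in\mathbb{R}^{m\times n}$ be the SJLT with column sparsity $s$. If $\max_{i,j}|A_{ij}|<(k\log n)^{-1/2}$ and $$m\gtrsim k(\log n)^8(\log m)/\varepsilon^2,\qquad s\gtrsim(\log n)^7(\log m)(\log\eta^{-1})/\varepsilon^2,$$ then with probability at least $1-\eta$, $$(1-\varepsilon)\|x\|_2^2\le\|\Phi x\|_2^2\le(1+\varepsilon)\|x\|_2^2\quad\text{for all }x\in T.$$
   Context: $\gtrsim$ means $\ge$ up to a universal constant factor. SJLT with column sparsity $s$: $\Phi_{ij}=s^{-1/2}\sigma_{ij}\delta_{ij}$ with $(\sigma_{ij})$ independent Rademachers, $(\delta_{ij})\in\{0,1\}$ independent of $\sigma$, each column has exactly $s$ ones, for fixed $j$ and distinct $i_1,\dots,i_k$: $\mathbb{E}\prod_t\delta_{i_tj}\le(s/m)^k$, and the columns $(\delta_{ij})_i$ are independent across $j$.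
   Formalization: The theorem assumes m ≥ 2; for m = 1 we have log m = 0, so both lower bounds are void, and the claim fails (for example n = 2, k = m = s = 1, A the normalized 2×2 Hadamard matrix, ε = 0.4, η = 1/2). *)

(* Defs.v *)
From HB Require Import structures.
From mathcomp Require Export all_boot all_order all_algebra.
From mathcomp Require Export all_classical all_reals all_analysis.

Set Implicit Arguments.
Unset Strict Implicit.
Unset Printing Implicit Defensive.
Import Order.TTheory GRing.Theory Num.Theory.
Import numFieldNormedType.Exports.

Local Open Scope classical_set_scope.
Local Open Scope ring_scope.

Section Euclidean.
Context {R : realType}.

(* The library norm `|x| on matrices is the sup norm, hence this definition. *)
Definition norm2 n (x : 'cV[R]_n) : R := Num.sqrt (\sum_i x i 0 ^+ 2).

Definition norm0 n (x : 'cV[R]_n) : nat := #|[set i | x i 0 != 0]%SET|.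

Definition sparse_sphere n k : set 'cV[R]_n :=
  [set x | norm2 x = 1 /\ (norm0 x <= k)%N].

Definition orthogonal_mx n (A : 'M[R]_n) : Prop := A^T *m A = 1%:M.

Definition max_entry n (A : 'M[R]_n) : R :=
  \big[Num.max/0]_(ij : 'I_n * 'I_n) `|A ij.1 ij.2|.

End Euclidean.

Arguments sparse_sphere {R} n k.

Section Independence.
Context {R : realType} {d : measure_display} {Omega : measurableType d}.
Variable P : probability Omega R.

(* The sigma-algebra sigma(X_i, i in I) on Omega. *)
Definition sigma_RV (I : Type) (X : I -> {RV P >-> R}) : set (set Omega) :=
  <<s \bigcup_i preimage_set_system setT (X i) measurable >>.

Definition mutually_independent (J : finType) (F : J -> set (set Omega)) : Prop :=
  forall (K : {set J}) (E : J -> set Omega),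
    (forall j, j \in K -> F j (E j)) ->
    P (\bigcap_(j in [set` K]) E j) = (\prod_(j in K) P (E j))%E.

Definition independent2 (F G : set (set Omega)) : Prop :=
  forall A B, F A -> G B -> P (A `&` B) = (P A * P B)%E.

Definition rademacher (X : {RV P >-> R}) : Prop :=
  P (X @^-1` [set 1]) = (2^-1)%:E /\ P (X @^-1` [set -1]) = (2^-1)%:E.

End Independence.

Section SJLT.
Context {R : realType} {d : measure_display} {Omega : measurableType d}.
Variable P : probability Omega R.
Variables m n : nat.

Record sjlt_data (s : nat) (sigma delta : 'I_m -> 'I_n -> {RV P >-> R}) : Prop := {
  sjlt_s_gt0 : (0 < s)%N ;
  sjlt_sigma_rademacher : forall i j, rademacher (sigma i j) ;
  sjlt_sigma_indep :
    mutually_independent P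
      (fun ij : 'I_m * 'I_n => sigma_RV (fun _ : unit => sigma ij.1 ij.2)) ;
  sjlt_delta01 :
    forall i j, {ae P, forall w, delta i j w = 0 \/ delta i j w = 1} ;
  sjlt_delta_sigma_indep :
    independent2 P
      (sigma_RV (fun ij : 'I_m * 'I_n => sigma ij.1 ij.2))
      (sigma_RV (fun ij : 'I_m * 'I_n => delta ij.1 ij.2)) ;
  sjlt_column_sparsity :
    forall j, {ae P, forall w, #|[set i | delta i j w == 1]%SET| = s} ;
  sjlt_neg_corr :
    forall (j : 'I_n) (I : {set 'I_m}),
      ('E_P[fun w => (\prod_(i in I) delta i j w)%R]
         <= ((s%:R / m%:R) ^+ #|I|)%:E)%E ;
  sjlt_columns_indep :
    mutually_independent P
      (fun j : 'I_n => sigma_RV (fun i : 'I_m => delta i j))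
}.

Definition is_sjlt (s : nat) (Phi : Omega -> 'M[R]_(m, n)) : Prop :=
  exists sigma delta : 'I_m -> 'I_n -> {RV P >-> R},
    sjlt_data s sigma delta /\
    forall w, Phi w =
      \matrix_(i, j) ((Num.sqrt s%:R)^-1 * sigma i j w * delta i j w).

End SJLT.

(* Main.v *)
Require Import Defs.
From mathcomp Require Import ring lra zify measurable_realfun.

(** Condition on the positions [delta] of the nonzero entries.  Off its diagonal,
    [|Phi x|^2 - |x|^2] is then a Rademacher chaos; averaging over random
    bipartitions of the columns decouples it into [<Phi_J x, Phi_(J^c) x>], which
    is linear in the signs of the columns in J once the others are fixed, with
    variance at most [max_i N_i(x)^2 |Phi_(J^c) x|^2], where
    [N_i(x)^2 = s^-1 \sum_j delta_ij x_j^2].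
    This is chained over nets of a finite set of sparse vectors. At scale [2^r]
    the nets come from Maurey's empirical method for the max of the norms [N_i]:
    they have [(2n+1)^(2^r)] points and precision [k V ln m / 2^r], where V
    bounds [N_i] squared on the columns of A.  Since [N_i(x)^2 <= |x|^2 / s], the
    deviation parameter [p ~ ln n ln (1/eta)] only costs [p / s] at every scale.
    The moments of [sup |Phi x|] on the right-hand side are reabsorbed because
    the chaining constant is small.  Finally V is controlled by a Chernoff bound
    on each row, which is where the coherence of A enters. *)

Set Implicit Arguments.
Unset Strict Implicit.
Unset Printing Implicit Defensive.
Import Order.TTheory GRing.Theory Num.Theory.
Import numFieldNormedType.Exports.

Local Open Scope classical_set_scope.
Local Open Scope ring_scope.

(** * Averages and exponential inequalities *)

Section Averages.
Context {R : realType}.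

(** Given the positions, the signs are uniform on a finite cube, so the analysis takes place on
    finite types with [avg] as expectation; the probability space returns only through the atoms on
    which all signs and positions are frozen. The decoupled form has a random variance, governed by
    the very supremum being estimated. This is why moments of order 2p are used: an inequality EX <=
    theta (1 + EX) with theta <= 1/2 can be solved for EX, and Markov's inequality at order 2p then
    yields exp(-2p). Entropy 2^r ln n times squared radius k V ln m / 2^r does not depend on r, so a
    single level [beta] serves all scales and the chain costs their number, about log k. The last
    net is the whole finite index set, reached once 2^r is of order k, so there is no limit to take.
    Two passages lead from infinitely many sparse vectors to fewer: polarization for the supremum,
    rational approximation for measurability. In both, the approximating vector must vanish wherever
    the given one does, to stay k-sparse. *)

Definition avg (T : finType) (f : T -> R) : R := (\sum_t f t) / #|T|%:R.

Lemma eq_avg (T : finType) (f g : T -> R) : f =1 g -> avg f = avg g.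
Proof. by move=> fg; congr (_ / _); apply: eq_bigr => t _; rewrite fg. Qed.

Lemma le_avg (T : finType) (f g : T -> R) :
  (forall t, f t <= g t) -> avg f <= avg g.
Proof. by move=> fg; rewrite ler_wpM2r// ler_sum. Qed.

Lemma avgD (T : finType) (f g : T -> R) :
  avg (fun t => f t + g t) = avg f + avg g.
Proof. by rewrite /avg big_split mulrDl. Qed.

Lemma avgZ (T : finType) (c : R) (f : T -> R) :
  avg (fun t => c * f t) = c * avg f.
Proof. by rewrite /avg -mulr_sumr mulrA. Qed.

Lemma avg_sum (T : finType) (I : Type) (r : seq I) (P : pred I)
    (f : I -> T -> R) :
  avg (fun t => \sum_(i <- r | P i) f i t) = \sum_(i <- r | P i) avg (f i).
Proof. by rewrite /avg exchange_big mulr_suml. Qed.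

Lemma avg_avg (T U : finType) (f : T -> U -> R) :
  avg (fun t => avg (f t)) = avg (fun u => avg (f^~ u)).
Proof. by rewrite /avg -!mulr_suml exchange_big mulrAC. Qed.

Lemma avg_cst (T : finType) (c : R) : (0 < #|T|)%N -> avg (fun _ : T => c) = c.
Proof.
move=> T0; rewrite /avg sumr_const -[c *+ _]mulr_natr mulfK//.
by rewrite pnatr_eq0 -lt0n.
Qed.

Lemma avg_ge0 (T : finType) (f : T -> R) : (forall t, 0 <= f t) -> 0 <= avg f.
Proof. by move=> f0; rewrite mulr_ge0// sumr_ge0. Qed.

Lemma avg_inv (T : finType) (h : T -> T) (f : T -> R) :
  involutive h -> avg (fun t => f (h t)) = avg f.
Proof.
move=> hK; congr (_ / _); rewrite [RHS](reindex_inj (inv_inj hK)) //.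
Qed.

(** Convexity of the power, as its tangent at [a]. The induction works because the gap at p + 2 is x
    times the gap at p + 1 plus a nonnegative multiple of (x - a)^2. *)
Lemma tangent_expr (x a : R) p : 0 <= x -> 0 <= a ->
  a ^+ p + p%:R * a ^+ p.-1 * (x - a) <= x ^+ p.
Proof.
move=> x0 a0; elim: p => [|[|p] IH]; first by rewrite !expr0 !mul0r addr0.
  by rewrite !expr1 expr0; lra.
rewrite -subr_ge0.
rewrite (_ : _ - _ = x * (x ^+ p.+1 - (a ^+ p.+1 + p.+1%:R * a ^+ p * (x - a)))
  + p.+1%:R * a ^+ p * (x - a) ^+ 2); last first.
  by rewrite /= !exprS -natr1 -[p.+1%:R]natr1; ring.
apply: addr_ge0; first by rewrite mulr_ge0// subr_ge0.
by rewrite mulr_ge0 ?sqr_ge0// mulr_ge0// exprn_ge0.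
Qed.

(** Jensen's inequality: averaging the tangent at the mean cancels its linear term. *)
Lemma exp_avg_le (T : finType) (f : T -> R) p : (0 < #|T|)%N ->
  (forall t, 0 <= f t) -> avg f ^+ p <= avg (fun t => f t ^+ p).
Proof.
move=> T0 f0; set a := avg f.
have a0 : 0 <= a by exact: avg_ge0.
have -> : a ^+ p = avg (fun t => a ^+ p + p%:R * a ^+ p.-1 * (f t - a)).
  rewrite avgD avgZ avgD !avg_cst// subrr mulr0 addr0//.
by apply: le_avg => t; exact: tangent_expr.
Qed.

Lemma exp_sum_le (T : finType) (f : T -> R) p : (0 < #|T|)%N ->
  (forall t, 0 <= f t) ->
  (\sum_t f t) ^+ p <= #|T|%:R ^+ p * avg (fun t => f t ^+ p).
Proof.
move=> T0 f0.
have -> : \sum_t f t = #|T|%:R * avg f.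
  by rewrite /avg mulrC mulfVK// pnatr_eq0 -lt0n.
by rewrite exprMn ler_wpM2l ?exprn_ge0// exp_avg_le.
Qed.

Lemma avg_markov (T : finType) (f : T -> R) (a : R) : 0 < a ->
  (forall t, 0 <= f t) ->
  #|[set t | a <= f t]%SET|%:R <= #|T|%:R * (avg f / a).
Proof.
move=> a0 f0; have [T0|T0] := posnP #|T|.
  have := max_card (mem [set t | a <= f t]%SET).
  by rewrite T0 leqn0 => /eqP ->; rewrite mul0r.
have -> : #|T|%:R * (avg f / a) = (\sum_t f t) / a.
  by rewrite mulrA; congr (_ / _); rewrite /avg mulrC mulfVK// pnatr_eq0 -lt0n.
rewrite ler_pdivlMr//.
rewrite -sum1_card natr_sum mulr_suml big_mkcond/=.
by apply: ler_sum => t _; rewrite inE; case: ifP => //; rewrite mul1r.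
Qed.

End Averages.

Section ExponentialBounds.
Context {R : realType}.
Implicit Types x : R.

(** Both cases invert 1 + y <= exp y: at y = -x for x <= 0, and at y = -x/2, followed by squaring,
    for 0 < x <= 1. Halving keeps the denominator 1 - x/2 away from 0. *)
Lemma expR_le_quadratic x : x <= 1 -> expR x <= 1 + x + 2 * x ^+ 2.
Proof.
move=> x1; have [x0|x0] := lerP x 0.
  have := expR_ge1Dx (- x); rewrite expRN => h.
  have e0 := expR_gt0 x.
  have {}h : expR x * (1 - x) <= 1.
    by rewrite mulrC -ler_pdivlMr// div1r.
  nra.
have := expR_ge1Dx (- (x / 2)); rewrite expRN => h.
have e0 := expR_gt0 (x / 2).
have {}h : expR (x / 2) * (1 - x / 2) <= 1.
  by rewrite mulrC -ler_pdivlMr// div1r.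
have -> : expR x = expR (x / 2) * expR (x / 2) by rewrite -expRD -splitr.
set y := expR (x / 2) in h e0 *.
have h2 : (y * (1 - x / 2)) * (y * (1 - x / 2)) <= 1.
  by rewrite -[leRHS]mulr1 ler_pM// mulr_ge0//; lra.
set z := 1 - x / 2 in h h2 *.
have z2 : 0 < z * z by rewrite mulr_gt0 /z; lra.
rewrite -(ler_pM2r z2); apply: (@le_trans _ _ 1); first by lra.
rewrite /z -subr_ge0.
rewrite (_ : _ - 1 = x ^+ 2 / 4 * ((1 - x) * (5 - 2 * x))); last by field.
by rewrite !mulr_ge0 ?sqr_ge0//; lra.
Qed.

(** The linear term stays outside the exponential, so it vanishes under any centred average: fair
    signs in [avg_expR_rad], a random atom in [maurey_step]. *)
Lemma expR_le_gauss x : expR x <= x + expR (2 * x ^+ 2).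
Proof.
have h := expR_ge1Dx (2 * x ^+ 2).
have [x1|x1] := lerP x 1; first by have := expR_le_quadratic x1; lra.
have : expR x <= expR (2 * x ^+ 2) by rewrite ler_expR; nra.
lra.
Qed.

Lemma expR_le1D3x x : 0 <= x <= 1 -> expR x <= 1 + 3 * x.
Proof. by case/andP=> x0 x1; have := expR_le_quadratic x1; nra. Qed.

(** Above B, (x / B)^p <= exp (p (x / B - 1)) and p / B <= lambda. This converts exponential bounds
    into moments. *)
Lemma expr_le_expR x (B lambda : R) p : 0 < B -> 0 <= x ->
  p%:R <= lambda * B -> x ^+ p <= B ^+ p * (1 + expR (lambda * (x - B))).
Proof.
move=> B0 x0 pl; have [xB|xB] := lerP x B.
  rewrite (@le_trans _ _ (B ^+ p))//; first by rewrite lerXn2r// nnegrE ltW.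
  by rewrite ler_peMr ?exprn_ge0 ?(ltW B0)// lerDl expR_ge0.
have -> : x = B * (x / B) by rewrite mulrC mulfVK// gt_eqF.
rewrite exprMn ler_wpM2l ?exprn_ge0 ?(ltW B0)//.
have -> : B * (x / B) = x by rewrite mulrC mulfVK// gt_eqF.
apply: (@le_trans _ _ (expR (lambda * (x - B)))); last by rewrite lerDr.
have xB1 : x / B <= expR (x / B - 1) by have := expR_ge1Dx (x / B - 1); lra.
apply: (le_trans (lerXn2r p _ _ xB1)); rewrite ?nnegrE ?expR_ge0//.
  by rewrite divr_ge0// ltW.
rewrite -expRM_natl ler_expR.
have -> : x / B - 1 = (x - B) / B by rewrite mulrBl divff// gt_eqF.
rewrite mulrA ler_pdivrMr// mulrAC ler_wpM2r// subr_ge0 ltW//.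
Qed.

End ExponentialBounds.

(** * Rademacher sums and decoupling *)

Section Rademacher.
Context {R : realType} {K : finType}.
Implicit Types (a : K -> R) (b : {ffun K -> bool}).

Definition sg (e : bool) : R := (-1) ^+ e.

Lemma sgD (e f : bool) : sg (e (+) f) = sg e * sg f.
Proof. by rewrite /sg signr_addb. Qed.

Lemma sg_sqr (e : bool) : sg e ^+ 2 = 1.
Proof. exact: sqrr_sign. Qed.

Definition rad a b : R := \sum_k sg (b k) * a k.

Lemma card_signs_gt0 : (0 < #|{ffun K -> bool}|)%N.
Proof. by rewrite card_ffun card_bool expn_gt0. Qed.

Lemma avg_prod_sign (F : K -> bool -> R) :
  avg (fun b => \prod_k F k (b k)) = \prod_k ((F k true + F k false) / 2).
Proof.
rewrite /avg card_ffun card_bool.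
rewrite -(bigA_distr_bigA (fun k e => F k e)) /= prodf_div prodr_const natrX.
by congr (_ / _); apply: eq_bigr => k _; rewrite big_bool.
Qed.

Lemma avg_expR_rad a (lambda : R) :
  avg (fun b => expR (lambda * rad a b))
    <= expR (2 * lambda ^+ 2 * \sum_k a k ^+ 2).
Proof.
have -> : avg (fun b => expR (lambda * rad a b)) =
    avg (fun b => \prod_k expR (lambda * (sg (b k) * a k))).
  by apply: eq_avg => b; rewrite /rad mulr_sumr expR_sum.
rewrite (avg_prod_sign (fun k e => expR (lambda * (sg e * a k)))).
rewrite mulr_sumr expR_sum; apply: ler_prod => k _; apply/andP; split.
  by rewrite divr_ge0// addr_ge0// expR_ge0.
have h1 := expR_le_gauss (lambda * a k).
have h2 := expR_le_gauss (- (lambda * a k)).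
rewrite /sg expr1 expr0 mul1r mulN1r mulrN.
rewrite sqrrN in h2; rewrite exprMn mulrA in h1 h2.
by rewrite ler_pdivrMr//; lra.
Qed.

Definition flip1 (k : K) b : {ffun K -> bool} := [ffun l => b l (+) (l == k)].

Lemma flip1K k : involutive (flip1 k).
Proof. by move=> b; apply/ffunP => l; rewrite !ffunE -addbA addbb addbF. Qed.

Lemma avg_sgM (k l : K) : avg (fun b => sg (b k) * sg (b l)) = (k == l)%:R.
Proof.
have [->|kl] := eqVneq k l.
  rewrite -[RHS](avg_cst _ card_signs_gt0); apply: eq_avg => b.
  by rewrite -expr2 sg_sqr.
have : avg (fun b => sg (b k) * sg (b l)) =
    - avg (fun b => sg (b k) * sg (b l)).
  rewrite -[LHS](avg_inv _ (flip1K k)) -[RHS]mulN1r -avgZ; apply: eq_avg => b.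
  by rewrite !ffunE eqxx eq_sym (negPf kl) addbT addbF /sg signrN; ring.
by rewrite mulr0n; lra.
Qed.

Lemma avg_rad_sqr a : avg (fun b => rad a b ^+ 2) = \sum_k a k ^+ 2.
Proof.
rewrite (@eq_avg _ _ _ (fun b => \sum_k \sum_l
    (a k * a l) * (sg (b k) * sg (b l)))); last first.
  move=> b; rewrite expr2 /rad big_distrlr/=; apply: eq_bigr => k _.
  by apply: eq_bigr => l _; ring.
rewrite avg_sum; apply: eq_bigr => k _; rewrite avg_sum (bigD1 k)//=.
rewrite avgZ avg_sgM eqxx mulr1 big1 ?addr0 ?expr2// => l lk.
by rewrite avgZ avg_sgM eq_sym (negPf lk) mulr0.
Qed.

(* Above the level B, [x ^+ (2 * p)] is at most B^(2p) exp (lambda (|x| - B));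
   the choice lambda = 2 P / B makes every exponential moment at most exp (-P),
   which pays for the union bound over E. *)
Lemma avg_max_rad (U : finType) (E : {set U}) (a : U -> K -> R)
    (v B P : R) (p : nat) :
  0 < B -> p%:R <= P -> 8 * P * v <= B ^+ 2 -> #|E|%:R <= expR P ->
  (forall u, u \in E -> \sum_k a u k ^+ 2 <= v) ->
  avg (fun b => (\big[Num.max/0]_(u in E) `|rad (a u) b|) ^+ (2 * p))
    <= 3 * B ^+ (2 * p).
Proof.
move=> B0 pP PvB EP av.
have P0 : 0 <= P by exact: le_trans pP.
pose lambda := 2 * P / B.
have lB : lambda * B = 2 * P by rewrite /lambda mulfVK// gt_eqF.
pose X b u := expR (- (lambda * B)) *
  (expR (lambda * rad (a u) b) + expR (- lambda * rad (a u) b)).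
have X0 b u : 0 <= X b u by rewrite mulr_ge0 ?addr_ge0 ?expR_ge0.
have B2p : 0 <= B ^+ (2 * p) by rewrite exprn_ge0// ltW.
apply: (@le_trans _ _
    (avg (fun b => B ^+ (2 * p) * (1 + \sum_(u in E) X b u)))).
  apply: le_avg => b; set Y := \big[_/_]_(u in E) _.
  have [] : 0 <= Y /\
      Y ^+ (2 * p) <= B ^+ (2 * p) * (1 + \sum_(u in E) X b u); last by [].
  rewrite /Y; elim/big_ind: _ => [|x y hx hy|u uE].
  - split=> //; case: (p) B2p => [|q] B2q.
      by rewrite !expr0 mul1r lerDl sumr_ge0.
    by rewrite expr0n/= mulr_ge0// addr_ge0// sumr_ge0.
  - by rewrite /Num.max; case: ifP.
  split=> //.
  have pl : (2 * p)%:R <= lambda * B by rewrite lB natrM ler_wpM2l.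
  apply: (le_trans (expr_le_expR B0 (normr_ge0 _) pl)).
  rewrite ler_wpM2l// lerD2l (bigD1 u)//= ler_wpDr ?sumr_ge0//.
  rewrite /X mulrBr addrC expRD ler_wpM2l ?expR_ge0//.
  have [r0|r0] := lerP 0 (rad (a u) b).
    by rewrite ger0_norm// lerDl expR_ge0.
  by rewrite ltr0_norm// mulrN -mulNr lerDr expR_ge0.
rewrite avgZ mulrC ler_wpM2r// avgD avg_cst ?card_signs_gt0// avg_sum.
suff : \sum_(u in E) avg (X^~ u) <= 2 by lra.
have Xle u : u \in E -> avg (X^~ u) <= 2 * expR (- P).
  move=> uE; rewrite /X avgZ avgD.
  have e : - (lambda * B) + 2 * lambda ^+ 2 * \sum_k a u k ^+ 2 <= - P.
    have h : 2 * lambda ^+ 2 * \sum_k a u k ^+ 2 <= 2 * lambda ^+ 2 * v.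
      by rewrite ler_wpM2l ?av// mulr_ge0// sqr_ge0.
    apply: (@le_trans _ _ (- (lambda * B) + 2 * lambda ^+ 2 * v)).
      by rewrite lerD2l.
    rewrite lB.
    have -> : 2 * lambda ^+ 2 * v = P * (8 * P * v / B ^+ 2).
      by rewrite /lambda; field; rewrite gt_eqF.
    have : P * (8 * P * v / B ^+ 2) <= P * 1.
      by rewrite ler_wpM2l// ler_pdivrMr ?exprn_gt0// mul1r.
    lra.
  have h1 := avg_expR_rad (a u) lambda.
  have := avg_expR_rad (a u) (- lambda); rewrite sqrrN => h2.
  apply: (@le_trans _ _ (expR (- (lambda * B)) *
    (2 * expR (2 * lambda ^+ 2 * \sum_k a u k ^+ 2)))).
    by rewrite ler_wpM2l ?expR_ge0//; lra.
  rewrite mulrCA -expRD ler_wpM2l// ler_expR//.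
apply: (le_trans (ler_sum _ Xle)); rewrite sumr_const -[leLHS]mulr_natr.
rewrite expRN -mulrA ler_piMr// mulrC ler_pdivrMr ?expR_gt0// mul1r//.
Qed.

End Rademacher.

Lemma sum_pair (R : realType) (I J : finType) (F : I * J -> R) :
  \sum_ij F ij = \sum_i \sum_j F (i, j).
Proof. by rewrite pair_big /=; apply: eq_bigr => -[]. Qed.

Section Decoupling.
Context {R : realType} {m n : nat}.
Variables (s : nat) (d : 'I_m -> 'I_n -> bool).
Local Notation signs := {ffun 'I_m * 'I_n -> bool}.
Local Notation sel := {ffun 'I_n -> bool}.
Implicit Types (b : signs) (tau : sel) (x u v : 'I_n -> R).

Local Notation c := ((Num.sqrt s%:R)^-1 : R).

(* The image of x under the columns of Phi selected by tau. *)
Definition psi tau b x (i : 'I_m) : R :=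
  c * \sum_j (tau j)%:R * (sg (b (i, j)) * ((d i j)%:R * x j)).

Definition allsel : sel := [ffun _ => true].
Definition nsel tau : sel := [ffun j => ~~ tau j].

(** This is N_i(x)^2, already squared. *)
Definition rownorm x (i : 'I_m) : R := s%:R^-1 * \sum_j (d i j)%:R * x j ^+ 2.

(** This is the off-diagonal part of |Phi x|^2 once every column of [d] has s ones, as [dcol] will
    assume. *)
Definition chaos b x : R :=
  \sum_i psi allsel b x i ^+ 2 - \sum_j x j ^+ 2.

Definition dchaos tau b u v : R :=
  \sum_i psi tau b u i * psi (nsel tau) b v i.

Definition flip tau b : signs := [ffun ij => b ij (+) tau ij.2].
Definition mix tau b b' : signs := [ffun ij => if tau ij.2 then b' ij else b ij].

Lemma flipK tau : involutive (flip tau).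
Proof. by move=> b; apply/ffunP => l; rewrite !ffunE -addbA addbb addbF. Qed.

Lemma nselK tau : nsel (nsel tau) = tau.
Proof. by apply/ffunP => j; rewrite !ffunE negbK. Qed.

Lemma dchaosC tau b u v : dchaos (nsel tau) b u v = dchaos tau b v u.
Proof. by apply: eq_bigr => i _; rewrite nselK mulrC. Qed.

Lemma psi_mix_sel tau b b' x i : psi tau (mix tau b b') x i = psi tau b' x i.
Proof.
congr (_ * _); apply: eq_bigr => j _; rewrite ffunE /=.
by case: (tau j) => //; rewrite !mul0r.
Qed.

Lemma psi_mix_nsel tau b b' x i :
  psi (nsel tau) (mix tau b b') x i = psi (nsel tau) b x i.
Proof.
congr (_ * _); apply: eq_bigr => j _; rewrite !ffunE /=.
by case: (tau j) => //; rewrite !mul0r.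
Qed.

(** Reversing the signs of the columns in tau writes partial images as a half difference and a half
    sum of full ones. This drives both the decoupling identity and the control of a partial image by
    full images at [b] and at [flip tau b], which have the same law. *)
Lemma psi_sel tau b x i :
  psi tau b x i = (psi allsel b x i - psi allsel (flip tau b) x i) / 2.
Proof.
rewrite /psi -mulrBr -mulrA; congr (_ * _).
rewrite -sumrB mulr_suml; apply: eq_bigr => j _.
by rewrite !ffunE sgD; case: (tau j); rewrite /sg /= ?expr1 ?expr0; field.
Qed.

Lemma psi_nsel tau b x i :
  psi (nsel tau) b x i = (psi allsel b x i + psi allsel (flip tau b) x i) / 2.
Proof.
rewrite /psi -mulrDr -mulrA; congr (_ * _).
rewrite -big_split mulr_suml; apply: eq_bigr => j _.
by rewrite !ffunE sgD; case: (tau j); rewrite /sg /= ?expr1 ?expr0; field.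
Qed.

Lemma psi_nsel_sqr_le tau b x :
  \sum_i psi (nsel tau) b x i ^+ 2 <=
  (\sum_i psi allsel b x i ^+ 2 + \sum_i psi allsel (flip tau b) x i ^+ 2) / 2.
Proof.
rewrite -big_split mulr_suml; apply: ler_sum => i _; rewrite psi_nsel /=.
move: (psi _ b _ _) (psi _ (flip _ _) _ _) => y z.
have -> : ((y + z) / 2) ^+ 2 = (y ^+ 2 + z ^+ 2) / 2 - ((y - z) / 2) ^+ 2.
  by field.
by rewrite lerBlDr lerDl sqr_ge0.
Qed.

Lemma psiB tau b u v i :
  psi tau b (fun j => u j - v j) i = psi tau b u i - psi tau b v i.
Proof.
rewrite /psi -mulrBr -sumrB; congr (_ * _); apply: eq_bigr => j _; ring.
Qed.

(** Expansion of a chain increment with the difference u - v always in the first slot: thanks to the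
    complementary selection, the columns carrying the difference are the randomized ones in both
    terms. *)
Lemma dchaosB_diag tau b (u v : 'I_n -> R) :
  dchaos tau b u u - dchaos tau b v v =
  dchaos tau b (fun j => u j - v j) u + dchaos (nsel tau) b (fun j => u j - v j) v.
Proof.
rewrite dchaosC /dchaos -sumrB -big_split/=; apply: eq_bigr => t _.
by rewrite !psiB; ring.
Qed.

Lemma sum_psi_sqr b x :
  \sum_i psi allsel b x i ^+ 2 = chaos b x + \sum_j x j ^+ 2.
Proof. by rewrite subrK. Qed.

Lemma invsqrt_sqr : c ^+ 2 = s%:R^-1.
Proof. by rewrite exprVn sqr_sqrtr. Qed.

(** With [b] frozen, a uniform selection multiplies the columns by independent fair signs, so only
    the diagonal survives. *)
Lemma avg_flip_psi_sqr b x i :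
  avg (fun tau => psi allsel (flip tau b) x i ^+ 2) = rownorm x i.
Proof.
pose a j := c * (sg (b (i, j)) * ((d i j)%:R * x j)).
rewrite (@eq_avg _ _ _ (fun tau => rad a tau ^+ 2)); last first.
  move=> tau; congr (_ ^+ 2); rewrite /psi /rad mulr_sumr; apply: eq_bigr => j _.
  by rewrite !ffunE sgD /a /=; ring.
rewrite avg_rad_sqr /rownorm mulr_sumr; apply: eq_bigr => j _.
rewrite /a !exprMn invsqrt_sqr sg_sqr mul1r; congr (_ * (_ * _)).
by case: (d i j); rewrite ?expr1n ?expr0n.
Qed.

Hypotheses (s_gt0 : (0 < s)%N)
  (dcol : forall j, (\sum_i d i j)%N = s).

Lemma sum_rownorm x : \sum_i rownorm x i = \sum_j x j ^+ 2.
Proof.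
rewrite -mulr_sumr exchange_big/= mulr_sumr; apply: eq_bigr => j _.
by rewrite -mulr_suml -natr_sum dcol mulKf// pnatr_eq0 -lt0n.
Qed.

(** Half difference times half sum is (psi(b)^2 - psi(flip tau b)^2) / 4, and the second square
    averages to the diagonal. Hence an exact identity, in which [dcol] turns the diagonal into
    |x|^2. *)
Lemma chaos_decoupling b x : chaos b x = 4 * avg (fun tau => dchaos tau b x x).
Proof.
have -> : avg (fun tau => dchaos tau b x x) =
   \sum_i avg (fun tau => psi tau b x i * psi (nsel tau) b x i).
  by rewrite -avg_sum.
rewrite mulr_sumr /chaos -sum_rownorm -sumrB; apply: eq_bigr => i _.
suff -> : avg (fun tau => psi tau b x i * psi (nsel tau) b x i) =
    4^-1 * (psi allsel b x i ^+ 2 - rownorm x i) by field.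
rewrite -(avg_flip_psi_sqr b).
transitivity (avg (fun tau => 4^-1 * (psi allsel b x i ^+ 2
   + -1 * psi allsel (flip tau b) x i ^+ 2))).
  by apply: eq_avg => tau; rewrite psi_nsel (psi_sel tau); field.
by rewrite avgZ avgD (avgZ (-1)) mulN1r avg_cst ?card_signs_gt0.
Qed.

(** Independence of the two blocks of signs: exchanging the selected entries of b and b' is an
    involution on pairs that carries [mix tau b b'] to b. *)
Lemma avg_mix tau (F : signs -> R) :
  avg F = avg (fun b => avg (fun b' => F (mix tau b b'))).
Proof.
rewrite {2 3}/avg -mulr_suml.
rewrite -(sum_pair (fun bb : signs * signs => F (mix tau bb.1 bb.2))).
pose h (bb : signs * signs) := (mix tau bb.1 bb.2, mix tau bb.2 bb.1).
have hK : involutive h.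
  move=> [b b']; rewrite /h /=; congr pair; apply/ffunP => ij; rewrite !ffunE;
  by case: (tau _).
rewrite (reindex_inj (inv_inj hK))/=.
rewrite (eq_bigr (fun bb : signs * signs => F bb.1)); last first.
  move=> [b b'] _ /=; congr F; apply/ffunP => ij; rewrite !ffunE.
  by case: (tau _).
rewrite (sum_pair (fun bb : signs * signs => F bb.1))/=.
have N0 : #|{: signs}|%:R != 0 :> R by rewrite pnatr_eq0 -lt0n card_signs_gt0.
rewrite (eq_bigr (fun b => F b * #|{: signs}|%:R)); last first.
  by move=> b _; rewrite sumr_const mulr_natr.
by rewrite -mulr_suml mulfK.
Qed.

(** The Rademacher bound averages only over the fresh copy b', so its level may be the random
    quantity beta * g b, matched to the variance rho2 * (g b)^2. *)
Lemma avg_max_dchaos tau (U : finType) (E : {set U}) (u v : U -> 'I_n -> R)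
    (g : signs -> R) (rho2 beta P : R) (p : nat) :
  0 < beta -> (forall b, 0 < g b) -> 0 <= rho2 -> p%:R <= P ->
  8 * P * rho2 <= beta ^+ 2 ->
  #|E|%:R <= expR P ->
  (forall e i, e \in E -> rownorm (u e) i <= rho2) ->
  (forall b e, e \in E -> \sum_i psi (nsel tau) b (v e) i ^+ 2 <= g b ^+ 2) ->
  avg (fun b =>
    (\big[Num.max/0]_(e in E) `|dchaos tau b (u e) (v e)|) ^+ (2 * p))
  <= 3 * beta ^+ (2 * p) * avg (fun b => g b ^+ (2 * p)).
Proof.
move=> beta0 g0 rho0 pP Pr EP ur vg; rewrite (avg_mix tau) -avgZ; apply: le_avg => b.
pose a e (ij : 'I_m * 'I_n) := (c * (tau ij.2)%:R * ((d ij.1 ij.2)%:R * u e ij.2))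
  * psi (nsel tau) b (v e) ij.1.
have aE b' : \big[Num.max/0]_(e in E)
      `|dchaos tau (mix tau b b') (u e) (v e)| =
    \big[Num.max/0]_(e in E) `|rad (a e) b'|.
  apply: eq_bigr => e _; congr `|_|; rewrite /dchaos /rad.
  rewrite sum_pair.
  apply: eq_bigr => i _; rewrite psi_mix_sel psi_mix_nsel {1}/psi mulr_sumr.
  by rewrite mulr_suml; apply: eq_bigr => j _; rewrite /a/=; ring.
rewrite (eq_avg (fun b' => congr1 (fun z => z ^+ (2 * p)) (aE b'))).
rewrite -mulrA -exprMn.
apply: (@avg_max_rad _ _ _ _ _ (rho2 * g b ^+ 2) _ P) => //.
- by rewrite mulr_gt0.
- by rewrite mulrA exprMn ler_wpM2r// sqr_ge0.
move=> e eE.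
rewrite sum_pair.
apply: (@le_trans _ _ (\sum_i rho2 * psi (nsel tau) b (v e) i ^+ 2)); last first.
  by rewrite -mulr_sumr ler_wpM2l ?vg.
apply: ler_sum => i _.
rewrite (eq_bigr (fun j => (s%:R^-1 * ((tau j)%:R * ((d i j)%:R * u e j ^+ 2)))
   * psi (nsel tau) b (v e) i ^+ 2)); last first.
  move=> j _; rewrite /a /= !exprMn invsqrt_sqr.
  by case: (tau j); case: (d i j); rewrite /=; ring.
rewrite -mulr_suml ler_wpM2r ?sqr_ge0//; apply: le_trans (ur e i eE).
rewrite -mulr_sumr ler_wpM2l// ler_sum// => j _.
by case: (tau j); rewrite ?mul1r// mul0r mulr_ge0 ?sqr_ge0.
Qed.

End Decoupling.

(** * Maurey's empirical method *)

Section WeightedNorms.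
Context {R : realType} {J : finType}.
Implicit Types (w x y z : J -> R).

Definition wnorm w x : R := \sum_j w j * x j ^+ 2.

Lemma wnorm_ge0 w x : (forall j, 0 <= w j) -> 0 <= wnorm w x.
Proof. by move=> w0; apply: sumr_ge0 => j _; rewrite mulr_ge0 ?sqr_ge0. Qed.

Lemma wnorm_expand w x y : wnorm w (fun j => x j + y j) =
  wnorm w x + 2 * (\sum_j w j * (x j * y j)) + wnorm w y.
Proof.
by rewrite mulr_sumr -!big_split/=; apply: eq_bigr => j _; ring.
Qed.

(** Lagrange's identity: twice the gap is the sum of w_j w_k (x_j y_k - x_k y_j)^2, which also
    covers vanishing weights. *)
Lemma weighted_cauchy_schwarz w x y : (forall j, 0 <= w j) ->
  (\sum_j w j * (x j * y j)) ^+ 2 <= wnorm w x * wnorm w y.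
Proof.
move=> w0.
suff : 0 <= 2 * (wnorm w x * wnorm w y - (\sum_j w j * (x j * y j)) ^+ 2).
  by rewrite pmulr_rge0// subr_ge0.
have -> : 2 * (wnorm w x * wnorm w y - (\sum_j w j * (x j * y j)) ^+ 2) =
    \sum_j \sum_k w j * w k * (x j * y k - x k * y j) ^+ 2.
  rewrite expr2 mulrBr mulr2n mulrDl mul1r {2}[wnorm w x * _]mulrC.
  rewrite /wnorm !big_distrlr/= mulrDl mul1r opprD -!sumrN -!big_split/=.
  apply: eq_bigr => j _; rewrite -!sumrN -!big_split/=; apply: eq_bigr => k _.
  ring.
by apply: sumr_ge0 => j _; apply: sumr_ge0 => k _;
  rewrite mulr_ge0 ?sqr_ge0// mulr_ge0.
Qed.

Lemma wnormB_le w x y z : (forall j, 0 <= w j) ->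
  wnorm w (fun j => x j - y j) <=
  2 * wnorm w (fun j => x j - z j) + 2 * wnorm w (fun j => y j - z j).
Proof.
move=> w0; rewrite !mulr_sumr -big_split/=; apply: ler_sum => j _.
rewrite ![2 * (w j * _)]mulrCA -mulrDr ler_wpM2l//.
by have := sqr_ge0 (x j + y j - 2 * z j); nra.
Qed.

End WeightedNorms.

Section Maurey.
Context {R : realType} {m : nat} {J Cc : finType}.
Variables (w : 'I_m -> J -> R) (e : Cc -> J -> R) (q : Cc -> R) (D : R).
Hypotheses (w0 : forall t j, 0 <= w t j) (q0 : forall c, 0 <= q c)
  (q1 : \sum_c q c = 1) (D0 : 0 < D).
Local Notation z := (fun j : J => \sum_c q c * e c j).
Hypothesis eD : forall t c, wnorm (w t) (fun j => e c j - z j) <= D.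

Lemma exists_le_mean (f : Cc -> R) (M : R) :
  \sum_c q c * f c <= M -> exists c, f c <= M.
Proof.
move=> fM; apply/not_existsP => fn.
have fc c : M < f c by rewrite ltNge; apply/negP/fn.
have q_eq0 c : q c = 0.
  have h0 c' : true -> 0 <= q c' * (f c' - M).
    by move=> _; rewrite mulr_ge0// subr_ge0 ltW.
  have h : \sum_c q c * (f c - M) = 0.
    apply/eqP; rewrite eq_le sumr_ge0// andbT.
    under eq_bigr do rewrite mulrBr.
    by rewrite sumrB -mulr_suml q1 mul1r subr_le0.
  have /eqP := h; rewrite psumr_eq0// => /allP/(_ c (mem_index_enum _)).
  by rewrite mulf_eq0 subr_eq0 (gt_eqF (fc c)) orbF => /eqP.
by move: q1; rewrite big1// => /esym/eqP; rewrite oner_eq0.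
Qed.

(** The sum of exponentials is a smooth stand-in for the maximum over the m rows. For c drawn with
    weights q the cross term is centred, so its exponential costs only its square, at most D times
    the current norm by Cauchy-Schwarz; this inflates lambda by 1 + 8 lambda D. *)
Lemma maurey_step (S : J -> R) (lambda : R) : 0 <= lambda ->
  exists c, \sum_t expR (lambda * wnorm (w t) (fun j => S j + (e c j - z j))) <=
    expR (lambda * D) *
    \sum_t expR (lambda * (1 + 8 * lambda * D) * wnorm (w t) S).
Proof.
move=> l0; apply: exists_le_mean; under eq_bigr do rewrite mulr_sumr.
rewrite exchange_big mulr_sumr; apply: ler_sum => t _ /=.
pose y c j := e c j - z j.
pose ip c := \sum_j w t j * (S j * y c j).
have Sw0 : 0 <= wnorm (w t) S by exact: wnorm_ge0.
have ip0 : \sum_c q c * ip c = 0.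
  under eq_bigr do rewrite mulr_sumr.
  rewrite exchange_big big1//= => j _.
  transitivity (w t j * S j * \sum_c q c * y c j).
    by rewrite mulr_sumr; apply: eq_bigr => c _; ring.
  rewrite /y; under eq_bigr do rewrite mulrBr.
  by rewrite sumrB -mulr_suml q1 mul1r subrr mulr0.
have ip2 c : ip c ^+ 2 <= wnorm (w t) S * D.
  apply: (le_trans (weighted_cauchy_schwarz _ _ (w0 t))).
  by rewrite ler_wpM2l// eD.
apply: (@le_trans _ _ (\sum_c q c *
    (expR (lambda * wnorm (w t) S + lambda * D) * (2 * lambda * ip c +
      expR (8 * lambda ^+ 2 * D * wnorm (w t) S))))).
  apply: ler_sum => c _; rewrite ler_wpM2l// (wnorm_expand _ S (y c)).
  apply: (@le_trans _ _ (expR (lambda * wnorm (w t) S + lambda * D) *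
      expR (2 * lambda * ip c))).
    rewrite -expRD ler_expR -/(ip c).
    have : lambda * wnorm (w t) (y c) <= lambda * D by rewrite ler_wpM2l ?eD.
    lra.
  rewrite ler_wpM2l ?expR_ge0//.
  apply: (le_trans (expR_le_gauss _)); rewrite lerD2l ler_expR.
  have : 8 * lambda ^+ 2 * ip c ^+ 2 <= 8 * lambda ^+ 2 * (wnorm (w t) S * D).
    by rewrite ler_wpM2l ?mulr_ge0 ?sqr_ge0.
  by rewrite !exprMn; lra.
under eq_bigr do rewrite mulrCA mulrDr.
rewrite -mulr_sumr big_split/= -mulr_suml q1 mul1r.
under eq_bigr do rewrite mulrCA.
rewrite -mulr_sumr ip0 mulr0 add0r -!expRD ler_expR; lra.
Qed.

(** With M = N + tau, the exponents 1 / (8 D M) are such that the inflation in [maurey_step] leads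
    from each to the one before, by (M + 2) / (M + 1)^2 <= 1 / M. Starting at M = N keeps the cost
    of a step below exp (1 / (8 N)), a bounded total after N steps. *)
Lemma maurey_greedy (N : nat) (tau : nat) : (0 < N)%N -> (tau <= N)%N ->
  exists2 l : seq Cc, size l = tau &
    \sum_t expR ((8 * D * (N + tau)%:R)^-1 *
      wnorm (w t) (fun j => \sum_(c <- l) (e c j - z j)))
    <= m%:R * expR (tau%:R / (8 * N%:R)).
Proof.
move=> N0; have N0' : 0 < N%:R :> R by rewrite ltr0n.
elim: tau => [_|tau IH tN].
  exists [::] => //; rewrite mul0r expR0 mulr1.
  rewrite (eq_bigr (fun=> 1)); last first.
    move=> t _; rewrite (_ : wnorm _ _ = 0) ?mulr0 ?expR0//.
    by apply: big1 => j _; rewrite big_nil expr0n mulr0.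
  by rewrite sumr_const card_ord.
have [l sl hl] := IH (ltnW tN).
pose lam : R := (8 * D * (N + tau.+1)%:R)^-1.
have C0 : 0 < (N + tau)%:R :> R by rewrite ltr0n addn_gt0 N0.
have C1 : (N + tau.+1)%:R = (N + tau)%:R + 1 :> R by rewrite addnS natr1.
have lam0 : 0 < lam by rewrite invr_gt0 C1 !mulr_gt0//; lra.
have [c hc] := maurey_step (fun j => \sum_(c <- l) (e c j - z j)) (ltW lam0).
exists (c :: l); first by rewrite /= sl.
have -> : (fun j => \sum_(c0 <- c :: l) (e c0 j - z j)) =
    (fun j => \sum_(c <- l) (e c j - z j) + (e c j - z j)).
  by apply/funext => j; rewrite big_cons addrC.
apply: (le_trans hc); rewrite -/lam.
have -> : m%:R * expR (tau.+1%:R / (8 * N%:R)) =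
    expR ((8 * N%:R)^-1) * (m%:R * expR (tau%:R / (8 * N%:R))) :> R.
  by rewrite mulrCA -expRD; congr (_ * expR _); rewrite -natr1; field; rewrite gt_eqF.
apply: ler_pM => //; rewrite ?expR_ge0 ?sumr_ge0// ?ler_expR.
- have -> : lam * D = (8 * (N + tau.+1)%:R)^-1.
    rewrite /lam C1; move: (N + tau)%:R C0 => C C0.
    by field; rewrite !gt_eqF ?addr_gt0.
  rewrite lef_pV2 ?posrE ?mulr_gt0// ?ltr0n ?addnS//.
  by rewrite ler_wpM2l// ler_nat -addnS leq_addr.
apply: le_trans hl; apply: ler_sum => t _; rewrite ler_expR ler_wpM2r//.
  exact: wnorm_ge0.
have -> : lam * (1 + 8 * lam * D) =
   (8 * D)^-1 * (((N + tau)%:R + 2) / ((N + tau)%:R + 1) ^+ 2).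
  rewrite /lam C1; move: (N + tau)%:R C0 => C C0.
  by field; rewrite !gt_eqF ?addr_gt0.
rewrite [leRHS]invfM ler_wpM2l ?invr_ge0 ?mulr_ge0 ?(ltW D0)//.
by rewrite ler_pdivrMr ?exprn_gt0 ?addr_gt0// mulrC ler_pdivlMr//; nra.
Qed.

Lemma ln_ge_half (x : R) : 2 <= x -> 2^-1 <= ln x.
Proof.
move=> x2; have x0 : 0 < x by lra.
rewrite -[2^-1]expRK ler_ln ?posrE ?expR_gt0//.
have := @expR_le_quadratic R 2^-1; lra.
Qed.

Lemma maurey (N : nat) : (1 < m)%N -> (0 < N)%N ->
  exists l : N.-tuple Cc, forall t,
    wnorm (w t) (fun j => z j - (N%:R^-1 * \sum_(c <- l) e c j))
      <= 32 * D * ln m%:R / N%:R.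
Proof.
move=> m1 N0; have N0' : 0 < N%:R :> R by rewrite ltr0n.
have [l sl hl] := maurey_greedy N0 (leqnn N).
have sl' : size l == N by rewrite sl.
exists (Tuple sl') => t /=.
set S := (fun j => \sum_(c <- l) (e c j - z j)) in hl.
have -> : wnorm (w t) (fun j => z j - (N%:R^-1 * \sum_(c <- l) e c j)) =
    N%:R ^- 2 * wnorm (w t) S.
  rewrite /wnorm mulr_sumr; apply: eq_bigr => j _; rewrite /S sumrB.
  rewrite big_const_seq count_predT sl iter_addr_0 -[z j *+ N]mulr_natr.
  by field; rewrite gt_eqF.
have mN : 0 < m%:R :> R by rewrite ltr0n ltnW.
(* As m >= 2, the bound 2 ln m absorbs the 1/8 accumulated over the N steps; with the final exponent
   1 / (16 D N) this produces the constant 32. *)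
have m2 : 2^-1 <= ln m%:R :> R by rewrite ln_ge_half// ler_nat.
have : expR ((8 * D * (N + N)%:R)^-1 * wnorm (w t) S) <=
    expR (ln m%:R + 8^-1).
  rewrite expRD lnK ?posrE//.
  have -> : 8^-1 = N%:R / (8 * N%:R) :> R by field; rewrite gt_eqF.
  by apply: le_trans hl; rewrite (bigD1 t)//= lerDl sumr_ge0.
rewrite ler_expR natrD => h.
have -> : N%:R ^- 2 * wnorm (w t) S =
   16 * D / N%:R * ((8 * D * (N%:R + N%:R))^-1 * wnorm (w t) S).
  by field; rewrite !gt_eqF ?addr_gt0.
have -> : 32 * D * ln m%:R / N%:R = 16 * D / N%:R * (2 * ln m%:R).
  by field; rewrite gt_eqF.
by rewrite ler_wpM2l ?divr_ge0 ?mulr_ge0 ?(ltW D0)//; lra.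
Qed.

End Maurey.

Lemma sum_unit_plus (R : realType) (T : finType) (F : unit + T -> R) :
  \sum_c F c = F (inl tt) + \sum_t F (inr t).
Proof.
rewrite big_sumType/=; congr (_ + _).
by rewrite (bigD1 tt)//= big1 ?addr0//; case.
Qed.

Section Nets.
Context {R : realType} {m n : nat}.
Variables (s : nat) (d : 'I_m -> 'I_n -> bool).

(** Maurey's averages need not be among the indexed vectors. Choosing one index in each class of
    equal averages keeps the net inside the index set, at the cost of a factor 4 in the squared
    distance. *)
Lemma exists_representatives (I C : finType) (f : I -> C) :
  exists2 pi : I -> I, forall i, f (pi i) = f i &
    (#|[set pi i | i in I]%SET| <= #|C|)%N.
Proof.
pose pi i := odflt i [pick i' | f i' == f i].
have fpi i : f (pi i) = f i.
  by rewrite /pi; case: pickP => [i' /eqP//|/(_ i)]; rewrite eqxx.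
have pi_eq i i' : f i = f i' -> pi i = pi i'.
  rewrite /pi => ->; case: pickP => //= /(_ i').
  by rewrite eqxx.
exists pi => //; rewrite -(card_in_imset (f := f)) ?max_card//.
move=> a b /imsetP[i _ ->] /imsetP[i' _ ->]; rewrite !fpi; exact: pi_eq.
Qed.

Lemma rownormE (x : 'I_n -> R) t :
  rownorm s d x t = wnorm (fun j => s%:R^-1 * (d t j)%:R) x.
Proof. by rewrite /rownorm mulr_sumr; apply: eq_bigr => j _; rewrite mulrA. Qed.

Variables (I : finType) (A : 'I_n -> 'I_n -> R) (y : I -> 'I_n -> R).
Variables (kappa V : R).
Local Notation x := (fun i j => \sum_l A j l * y i l).
Hypotheses (kappa0 : 0 < kappa) (V0 : 0 < V) (m1 : (1 < m)%N)
  (y1 : forall i, \sum_l `|y i l| <= kappa)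
  (AV : forall t l, rownorm s d (fun j => A j l) t <= V).

Local Notation atom := (unit + 'I_n * bool)%type.

(** The atoms are 0 and the columns of A scaled by kappa, with both signs; [wt i] makes x i a convex
    combination of these 2n + 1 points, the zero atom taking up the slack in the l1 bound. *)
Let vec (c : atom) (j : 'I_n) : R :=
  if c is inr (l, e) then kappa * (sg e * A j l) else 0.

Let wt (i : I) (c : atom) : R :=
  if c is inr (l, e) then (if e == (y i l < 0) then `|y i l| / kappa else 0)
  else 1 - (\sum_l `|y i l|) / kappa.

Let sum_atom (F : atom -> R) :
  \sum_c F c = F (inl tt) + \sum_l (F (inr (l, true)) + F (inr (l, false))).
Proof.
by rewrite sum_unit_plus sum_pair; congr (_ + _); apply: eq_bigr => l _; rewrite big_bool.
Qed.

Lemma maurey_net (N : nat) : (0 < N)%N ->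
  exists2 pi : I -> I,
    (#|[set pi i | i in I]%SET| <= (2 * n + 1) ^ N)%N &
    forall i t, rownorm s d (fun j => x i j - x (pi i) j) t
      <= 512 * (kappa ^+ 2 * V) * ln m%:R / N%:R.
Proof.
move=> N0.
have w0 t j : 0 <= s%:R^-1 * (d t j)%:R :> R by rewrite mulr_ge0.
(* An atom and x i both have squared norm at most kappa^2 V, whence 2 + 2 = 4. Then 512 = 4 * 32 *
   4, the last factor from comparing two points through a common average. *)
pose D := 4 * (kappa ^+ 2 * V).
have D0 : 0 < D by rewrite !mulr_gt0// exprn_gt0.
have wt0 i c : 0 <= wt i c.
  case: c => [_|[l e]]/=; last by case: ifP => // _; rewrite divr_ge0// ltW.
  by rewrite subr_ge0 ler_pdivrMr// mul1r.
have wt1 i : \sum_c wt i c = 1.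
  rewrite sum_atom /= mulr_suml.
  rewrite [X in _ + X = _](eq_bigr (fun l => `|y i l| / kappa)) ?subrK// => l _.
  by case: (y i l < 0); rewrite /= ?addr0 ?add0r.
have xE i j : \sum_c wt i c * vec c j = x i j.
  rewrite sum_atom /= mulr0 add0r; apply: eq_bigr => l _.
  have : y i l = (if y i l < 0 then - `|y i l| else `|y i l|).
    have [h|h] := boolP (y i l < 0); first by rewrite ltr0_norm// opprK.
    by rewrite ger0_norm// leNgt.
  case: (y i l < 0) => yE; rewrite [in RHS]yE /= /sg ?expr1 ?expr0;
  by field; exact: lt0r_neq0.
have vecV t c : wnorm (fun j => s%:R^-1 * (d t j)%:R) (vec c) <= kappa ^+ 2 * V.
  have kV0 : 0 <= kappa ^+ 2 * V by rewrite mulr_ge0 ?sqr_ge0// ltW.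
  case: c => [[]|[l e]].
    rewrite /wnorm big1// => j _; rewrite /= expr0n mulr0//.
  apply: (@le_trans _ _ (kappa ^+ 2 * rownorm s d (fun j => A j l) t)); last first.
    by rewrite ler_wpM2l ?sqr_ge0.
  rewrite rownormE /wnorm mulr_sumr le_eqVlt; apply/orP; left; apply/eqP.
  by apply: eq_bigr => j _; rewrite /= !exprMn sg_sqr; ring.
have xV t i : wnorm (fun j => s%:R^-1 * (d t j)%:R) (x i) <= kappa ^+ 2 * V.
  apply: (@le_trans _ _
    (\sum_c wt i c * wnorm (fun j => s%:R^-1 * (d t j)%:R) (vec c))).
    rewrite /wnorm; under [leRHS]eq_bigr do rewrite mulr_sumr.
    rewrite exchange_big; apply: ler_sum => j _ /=; rewrite -xE.
    under [leRHS]eq_bigr do rewrite mulrCA.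
    rewrite -mulr_sumr ler_wpM2l//.
    have := weighted_cauchy_schwarz (fun c => vec c j) (fun=> 1) (wt0 i).
    have -> : wnorm (wt i) (fun=> 1) = 1.
      by rewrite -[RHS](wt1 i); apply: eq_bigr => c _; rewrite expr1n mulr1.
    by rewrite mulr1; under eq_bigr do rewrite mulr1.
  apply: (@le_trans _ _ (\sum_c wt i c * (kappa ^+ 2 * V))).
    by apply: ler_sum => c _; rewrite ler_wpM2l.
  by rewrite -mulr_suml wt1 mul1r.
have eD i t c : wnorm (fun j => s%:R^-1 * (d t j)%:R)
    (fun j => vec c j - \sum_c wt i c * vec c j) <= D.
  have -> : (fun j => vec c j - \sum_c wt i c * vec c j) =
      (fun j => vec c j - x i j) by apply/funext => j; rewrite xE.
  apply: (le_trans (wnormB_le (vec c) (x i) (fun=> 0) (w0 t))).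
  have e0 (f : 'I_n -> R) : (fun j => f j - 0) = f.
    by apply/funext => j; rewrite subr0.
  rewrite (e0 (vec c)) (e0 (x i)).
  by have := vecV t c; have := xV t i; rewrite /D; lra.
have /choice[cls clsP] i := maurey w0 (wt0 i) (wt1 i) D0 (eD i) m1 N0.
have [pi piP pi_card] := exists_representatives cls.
exists pi.
  by rewrite (leq_trans pi_card)// card_tuple card_sum card_unit card_prod
    card_ord card_bool mulnC addnC.
move=> i t; rewrite rownormE.
have h1 := clsP i t; have h2 := clsP (pi i) t; rewrite piP in h2.
pose ctr j := N%:R^-1 * \sum_(c <- cls i) vec c j.
apply: (le_trans (wnormB_le (x i) (x (pi i)) ctr (w0 t))).
have e1 i' : (fun j => \sum_c wt i' c * vec c j - N%:R^-1 * \sum_(c <- cls i) vec c j)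
   = (fun j => x i' j - ctr j) by apply/funext => j; rewrite xE.
rewrite e1 in h1; rewrite e1 in h2.
have -> : 512 * (kappa ^+ 2 * V) * ln m%:R / N%:R =
  2 * (32 * D * ln m%:R / N%:R) + 2 * (32 * D * ln m%:R / N%:R).
  by rewrite /D; ring.
by rewrite lerD// ler_wpM2l.
Qed.

End Nets.

(** * Chaining *)

Section Chaining.
Context {R : realType} {m n : nat}.
Variables (s : nat) (d : 'I_m -> 'I_n -> bool).
Hypotheses (s_gt0 : (0 < s)%N) (dcol : forall j, (\sum_i d i j)%N = s).
Variables (I : finType) (x : I -> 'I_n -> R).
Hypothesis x1 : forall i, \sum_j x i j ^+ 2 <= 1.
Local Notation signs := {ffun 'I_m * 'I_n -> bool}.
Local Notation sel := {ffun 'I_n -> bool}.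
Local Notation chaos := (chaos s d).
Local Notation dchaos := (dchaos s d).
Local Notation psi := (psi s d).
Local Notation rownorm := (rownorm s d).

Definition max_chaos (b : signs) : R := \big[Num.max/0]_i `|chaos b (x i)|.

Let X := max_chaos.

Lemma max_chaos_ge0 b : 0 <= X b.
Proof. by rewrite /X /max_chaos; elim/big_ind: _ => // y z *; rewrite le_max; apply/orP; left. Qed.

(** The summand 1 makes this a strictly positive level, as [avg_max_dchaos] requires. *)
Let g (tau : sel) (b : signs) : R :=
  Num.sqrt (1 + \big[Num.max/0]_i \sum_t psi (nsel tau) b (x i) t ^+ 2).

Let gmax_ge0 tau b :
  0 <= \big[Num.max/0]_i \sum_t psi (nsel tau) b (x i) t ^+ 2.
Proof.
elim/big_ind: _ => // [y z *|i _]; first by rewrite le_max; apply/orP; left.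
by apply: sumr_ge0 => *; exact: sqr_ge0.
Qed.

Let g_gt0 tau b : 0 < g tau b.
Proof. by rewrite sqrtr_gt0 ltr_pwDl. Qed.

Let psi_le_g tau b i : \sum_t psi (nsel tau) b (x i) t ^+ 2 <= g tau b ^+ 2.
Proof.
rewrite sqr_sqrtr ?addr_ge0//.
apply: le_trans (_ : _ <= \big[Num.max/0]_i \sum_t psi (nsel tau) b (x i) t ^+ 2) _.
  exact: (le_bigmax 0 (fun i => \sum_t psi (nsel tau) b (x i) t ^+ 2)).
by rewrite lerDr.
Qed.

Let psi_all_le b i : \sum_t psi allsel b (x i) t ^+ 2 <= 1 + X b.
Proof.
have h : `|chaos b (x i)| <= X b by exact: (le_bigmax 0 (fun i => `|chaos b (x i)|)).
have := x1 i; have := le_trans (ler_norm _) h.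
by rewrite sum_psi_sqr; lra.
Qed.

Lemma exp_half_sum_le (u v : R) p : 0 <= u -> 0 <= v ->
  ((u + v) / 2) ^+ p <= u ^+ p + v ^+ p.
Proof.
move=> u0 v0; have [uv|/ltW uv] := lerP u v.
  apply: (@le_trans _ _ (v ^+ p)); last by rewrite lerDr exprn_ge0.
  by rewrite lerXn2r ?nnegrE//; lra.
apply: (@le_trans _ _ (u ^+ p)); last by rewrite lerDl exprn_ge0.
by rewrite lerXn2r ?nnegrE//; lra.
Qed.

(** Raising the order from p to 2p makes the moment being estimated reappear on the right; 9 = 3^2
    later merges with beta into (3 beta)^(2p). *)
Lemma exp_2D_le (u : R) p : 0 <= u -> (2 + u) ^+ p <= 9 ^+ p * (1 + u ^+ (2 * p)).
Proof.
move=> u0; rewrite exprM.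
have [u1|u1] := lerP u 1.
  apply: (@le_trans _ _ (9 ^+ p)); last first.
    by rewrite ler_peMr ?exprn_ge0// lerDl exprn_ge0// sqr_ge0.
  by rewrite lerXn2r ?nnegrE//; lra.
apply: (@le_trans _ _ (9 ^+ p * (u ^+ 2) ^+ p)); last first.
  by rewrite ler_wpM2l ?exprn_ge0// lerDr.
by rewrite -exprMn lerXn2r ?nnegrE ?mulr_ge0 ?sqr_ge0//; nra.
Qed.

(** The square of g is at most the mean of 2 + X at [b] and at [flip tau b], whose powers have equal
    averages. *)
Let avg_g tau p : avg (fun b => g tau b ^+ (2 * p)) <=
  2 * 9 ^+ p * (1 + avg (fun b => X b ^+ (2 * p))).
Proof.
apply: (@le_trans _ _ (avg (fun b : signs => (2 + X b) ^+ p +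
    (2 + X (flip tau b)) ^+ p))).
  apply: le_avg => b; rewrite exprM sqr_sqrtr ?addr_ge0//.
  have X0 := max_chaos_ge0 b; have X1 := max_chaos_ge0 (flip tau b).
  apply: le_trans (exp_half_sum_le p _ _); rewrite ?addr_ge0//.
  rewrite lerXn2r ?nnegrE ?addr_ge0 ?divr_ge0 ?addr_ge0//.
  suff : \big[Num.max/0]_i \sum_t psi (nsel tau) b (x i) t ^+ 2 <=
    ((1 + X b) + (1 + X (flip tau b))) / 2 by lra.
  apply: bigmax_le => [|i _]; first by rewrite divr_ge0 ?addr_ge0.
  apply: (le_trans (psi_nsel_sqr_le _ _ _ _ _)).
  by have := psi_all_le b i; have := psi_all_le (flip tau b) i; lra.
rewrite avgD (avg_inv (fun b => (2 + X b) ^+ p) (flipK tau)).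
suff : avg (fun b => (2 + X b) ^+ p) <=
    9 ^+ p * (1 + avg (fun b => X b ^+ (2 * p))) by lra.
have -> : 1 + avg (fun b => X b ^+ (2 * p)) = avg (fun b => 1 + X b ^+ (2 * p)).
  by rewrite avgD avg_cst ?card_signs_gt0.
by rewrite -avgZ; apply: le_avg => b; apply: exp_2D_le; exact: max_chaos_ge0.
Qed.

Variables (r0 : nat) (pi : nat -> I -> I) (P rho2 : nat -> R) (beta : R) (p : nat).
Hypotheses (pi_id : forall i, pi r0 i = i) (beta0 : 0 < beta)
  (pP : forall r, (r <= r0)%N -> p%:R <= P r)
  (rho0 : forall r, 0 <= rho2 r)
  (Pbeta : forall r, (r <= r0)%N -> 8 * P r * rho2 r <= beta ^+ 2)
  (card0 : #|[set pi 0 i | i in I]%SET|%:R <= expR (P 0))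
  (cardS : forall r, (r < r0)%N ->
     #|[set (pi r.+1 i, pi r i) | i in I]%SET|%:R <= expR (P r.+1))
  (row0 : forall i t, rownorm (x i) t <= rho2 0)
  (rowS : forall r i t, (r < r0)%N ->
     rownorm (fun j => x (pi r.+1 i) j - x (pi r i) j) t <= rho2 r.+1).

Let K : R := (r0 * 2 + 1)%:R.

(** The value at x i telescopes along the chain into 2 r0 + 1 pieces, one coarse and two per scale.
    Convexity of the power over the pieces plays the part of the triangle inequality in L^(2p) and
    produces the factor K. *)
Lemma avg_max_dchaos_diag tau :
  avg (fun b => (\big[Num.max/0]_i `|dchaos tau b (x i) (x i)|) ^+ (2 * p)) <=
  6 * (3 * K * beta) ^+ (2 * p) * (1 + avg (fun b => X b ^+ (2 * p))).
Proof.
pose E r := [set (pi r.+1 i, pi r i) | i in I]%SET.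
pose Y (c : unit + 'I_r0 * bool) (b : signs) : R := match c with
  | inl _ => \big[Num.max/0]_(i in [set pi 0 i | i in I]%SET)
        `|dchaos tau b (x i) (x i)|
  | inr (r, true) => \big[Num.max/0]_(e in E r)
        `|dchaos tau b (fun j => x e.1 j - x e.2 j) (x e.1)|
  | inr (r, false) => \big[Num.max/0]_(e in E r)
        `|dchaos (nsel tau) b (fun j => x e.1 j - x e.2 j) (x e.2)|
  end.
have max_ge0 (U : finType) (Q : pred U) (f : U -> R) :
    0 <= \big[Num.max/0]_(i | Q i) `|f i|.
  by elim/big_ind: _ => // y z *; rewrite le_max; apply/orP; left.
have Y0 c b : 0 <= Y c b by case: c => [[]|[r []]]; exact: max_ge0.
set M := 1 + avg (fun b => X b ^+ (2 * p)).
have YP c : avg (fun b => Y c b ^+ (2 * p)) <= 6 * (3 * beta) ^+ (2 * p) * M.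
  have -> : 6 * (3 * beta) ^+ (2 * p) * M =
      3 * beta ^+ (2 * p) * (2 * 9 ^+ p * M).
    by rewrite exprMn [3 ^+ (2 * p)]exprM (_ : 3 ^+ 2 = 9 :> R); ring.
  have b0 : 0 <= 3 * beta ^+ (2 * p) by rewrite mulr_ge0// exprn_ge0// ltW.
  case: c => [[]|[r []]].
  - apply: le_trans (ler_wpM2l b0 (avg_g tau p)).
    apply: (avg_max_dchaos (rho2 := rho2 0) (P := P 0)
      (u := fun i => x i) (v := fun i => x i)) => //; [exact: pP|exact: Pbeta].
  - apply: le_trans (ler_wpM2l b0 (avg_g tau p)).
    apply: (avg_max_dchaos (rho2 := rho2 r.+1) (P := P r.+1)
      (u := fun e j => x e.1 j - x e.2 j) (v := fun e => x e.1)) => //.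
    + exact: pP. + exact: Pbeta. + exact: cardS.
    by move=> e t /imsetP[i _ ->]/=; exact: rowS.
  - apply: le_trans (ler_wpM2l b0 (avg_g (nsel tau) p)).
    apply: (avg_max_dchaos (rho2 := rho2 r.+1) (P := P r.+1)
      (u := fun e j => x e.1 j - x e.2 j) (v := fun e => x e.2)) => //.
    + exact: pP. + exact: Pbeta. + exact: cardS.
    by move=> e t /imsetP[i _ ->]/=; exact: rowS.
have cardT : #|{: unit + 'I_r0 * bool}| = (r0 * 2 + 1)%N.
  by rewrite card_sum card_unit card_prod card_ord card_bool addnC.
have cardT0 : (0 < #|{: unit + 'I_r0 * bool}|)%N by rewrite cardT addn1.
have dY b i : `|dchaos tau b (x i) (x i)| <= \sum_c Y c b.
  have -> : dchaos tau b (x i) (x i) = dchaos tau b (x (pi 0 i)) (x (pi 0 i)) +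
     \sum_(r < r0) (dchaos tau b (x (pi r.+1 i)) (x (pi r.+1 i)) -
        dchaos tau b (x (pi r i)) (x (pi r i))).
    have := telescope_sumr (fun r => dchaos tau b (x (pi r i)) (x (pi r i))) (leq0n r0).
    by rewrite big_mkord => ->; rewrite pi_id addrC subrK.
  rewrite sum_unit_plus sum_pair; apply: (le_trans (ler_normD _ _)); apply: lerD.
    apply: (le_bigmax_cond 0 (fun i => `|dchaos tau b (x i) (x i)|)).
    exact: imset_f.
  apply: (le_trans (ler_norm_sum _ _ _)); apply: ler_sum => r _.
  rewrite big_bool/= dchaosB_diag; apply: (le_trans (ler_normD _ _)).
  have iE : (pi r.+1 i, pi r i) \in E r by exact: imset_f.
  apply: lerD.
    exact: (le_bigmax_cond 0 (fun e : I * I =>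
      `|dchaos tau b (fun j => x e.1 j - x e.2 j) (x e.1)|) iE).
  exact: (le_bigmax_cond 0 (fun e : I * I =>
    `|dchaos (nsel tau) b (fun j => x e.1 j - x e.2 j) (x e.2)|) iE).
apply: (@le_trans _ _ (avg (fun b => K ^+ (2 * p) *
    avg (fun c => Y c b ^+ (2 * p))))).
  apply: le_avg => b; rewrite /K -cardT.
  apply: le_trans (exp_sum_le (2 * p) cardT0 (Y0^~ b)).
  rewrite lerXn2r ?nnegrE ?sumr_ge0//.
  by apply: bigmax_le; rewrite ?sumr_ge0.
have -> : 6 * (3 * K * beta) ^+ (2 * p) * M =
    K ^+ (2 * p) * (6 * (3 * beta) ^+ (2 * p) * M) by rewrite !exprMn; ring.
rewrite avgZ avg_avg ler_wpM2l ?exprn_ge0//.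
by rewrite -[leRHS](avg_cst _ cardT0); apply: le_avg => c; exact: YP.
Qed.

Lemma avg_max_chaos : 6 * (12 * K * beta) ^+ (2 * p) <= 2^-1 ->
  avg (fun b => X b ^+ (2 * p)) <= 12 * (12 * K * beta) ^+ (2 * p).
Proof.
move=> small; set EX := avg _.
have EX0 : 0 <= EX.
  by apply: avg_ge0 => b; rewrite exprn_ge0// max_chaos_ge0.
have selT : (0 < #|{: sel}|)%N by exact: card_signs_gt0.
pose D tau b : R := \big[Num.max/0]_i `|dchaos tau b (x i) (x i)|.
have D0 tau b : 0 <= D tau b.
  by rewrite /D; elim/big_ind: _ => // y z *; rewrite le_max; apply/orP; left.
(* The decoupling factor 4 times 3 gives 12. With theta = 6 (12 K beta)^(2p) <= 1/2 this reads EX <=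
   theta (1 + EX), hence EX <= 2 theta. *)
suff : EX <= 4 ^+ (2 * p) * (6 * (3 * K * beta) ^+ (2 * p) * (1 + EX)).
  have -> : 4 ^+ (2 * p) * (6 * (3 * K * beta) ^+ (2 * p) * (1 + EX)) =
     6 * (12 * K * beta) ^+ (2 * p) * (1 + EX).
    rewrite (_ : 12 * K * beta = 4 * (3 * K * beta)) ?exprMn; ring.
  nra.
apply: (@le_trans _ _ (avg (fun b => 4 ^+ (2 * p) *
    avg (fun tau => D tau b ^+ (2 * p))))).
  apply: le_avg => b.
  apply: le_trans (_ : (4 * avg (fun tau => D tau b)) ^+ (2 * p) <= _).
    have D1 : 0 <= avg (D^~ b) by exact: avg_ge0.
    apply: lerXn2r; rewrite ?nnegrE; [exact: max_chaos_ge0|by rewrite mulr_ge0|].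
    rewrite /X /max_chaos; apply: bigmax_le => [|i _]; first by rewrite mulr_ge0.
    rewrite chaos_decoupling// normrM ger0_norm// ler_wpM2l//.
    rewrite /avg normrM [`|_^-1|]ger0_norm// ler_wpM2r//.
    apply: (le_trans (ler_norm_sum _ _ _)); apply: ler_sum => tau _.
    exact: (le_bigmax 0 (fun i => `|dchaos tau b (x i) (x i)|)).
  rewrite exprMn ler_wpM2l ?exprn_ge0//.
  exact: (exp_avg_le (2 * p) selT (D0^~ b)).
rewrite avgZ avg_avg ler_wpM2l ?exprn_ge0//.
rewrite -[leRHS](avg_cst _ selT); apply: le_avg => tau.
exact: avg_max_dchaos_diag.
Qed.

End Chaining.

(** * Sparse vectors *)

Lemma sum_indicator (R : realType) (T : finType) (Q : pred T) :
  \sum_t (Q t)%:R = #|[set t | Q t]%SET|%:R :> R.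
Proof.
by rewrite -sum1dep_card natr_sum [RHS]big_mkcond/=; apply: eq_bigr => t _; case: (Q t).
Qed.

Section SparseNet.
Context {R : realType} {n : nat}.
Implicit Types z : 'I_n -> R.

Definition usparse (k : nat) z : Prop :=
  \sum_l z l ^+ 2 = 1 /\ (#|[set l | (z l != 0)%R]%SET| <= k)%N.

Lemma sparse_l1_le k z : usparse k z -> \sum_l `|z l| <= Num.sqrt k%:R.
Proof.
case=> z1 zk.
have w0 l : 0 <= (z l != 0)%:R :> R by [].
have := weighted_cauchy_schwarz (fun l => `|z l|) (fun=> 1) w0.
have -> : \sum_l (z l != 0)%:R * (`|z l| * 1) = \sum_l `|z l|.
  apply: eq_bigr => l _; rewrite mulr1; have [->|_] := eqVneq (z l) 0.
    by rewrite normr0 mulr0.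
  by rewrite mul1r.
have -> : wnorm (fun l => (z l != 0)%:R) (fun l => `|z l|) = 1.
  rewrite -[RHS]z1; apply: eq_bigr => l _; rewrite real_normK ?num_real//.
  by have [->|_] := eqVneq (z l) 0; rewrite ?expr0n ?mulr0 ?mul1r.
have -> : wnorm (fun l => (z l != 0)%:R) (fun=> 1) =
    #|[set l | z l != 0]%SET|%:R :> R.
  by rewrite -sum_indicator; apply: eq_bigr => l _; rewrite expr1n mulr1.
move=> h; rewrite -[leLHS]ger0_norm ?sumr_ge0// -sqrtr_sqr.
rewrite ler_sqrt// (le_trans h)// mul1r ler_nat//.
Qed.

(** Surplus indices repeat an element of S, so the image is exactly S; nonemptiness provides that
    element. *)
Lemma exists_enumeration (k : nat) (S : {set 'I_n}) :
  S != finset.set0 -> (#|S| <= k)%N ->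
  exists f : {ffun 'I_k -> 'I_n}, S = [set f t | t in 'I_k]%SET.
Proof.
move=> /set0Pn[l0 l0S] Sk.
exists [ffun t : 'I_k => nth l0 (enum S) t].
apply/setP => l; apply/idP/imsetP => [lS|[t _ ->]]; last first.
  rewrite ffunE; have [tS|tS] := ltnP t (size (enum S)).
    by rewrite -mem_enum mem_nth.
  by rewrite nth_default.
have il : (index l (enum S) < k)%N.
  by rewrite (leq_trans _ Sk)// cardE index_mem mem_enum.
by exists (Ordinal il) => //; rewrite ffunE nth_index// mem_enum.
Qed.

(** The code of a vector lists its support and, for each listed coordinate, the sign and the modulus
    rounded to multiples of 1 / (4 sqrt k). Vectors with equal codes share their support and differ
    by at most 1 / (4 sqrt k) on at most k coordinates, whence 1/16. An attained code is decoded to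
    a sparse unit vector, any other to 0, and the number of codes is explicit. *)
Lemma sparse_net k : (0 < n)%N -> (0 < k)%N ->
  exists y : {ffun 'I_k -> 'I_n * (bool * 'I_(4 * k + 1))} -> 'I_n -> R,
  [/\ forall i, \sum_l y i l ^+ 2 <= 1,
      forall i, \sum_l `|y i l| <= Num.sqrt k%:R &
      forall z, usparse k z -> exists2 i, forall l, z l = 0 -> y i l = 0 &
        \sum_l (z l - y i l) ^+ 2 <= 16^-1].
Proof.
move=> n0 k0; have k1 : 1 <= k%:R :> R by rewrite ler1n.
pose kap : R := Num.sqrt k%:R.
have kap2 : kap ^+ 2 = k%:R by rewrite sqr_sqrtr.
have kap1 : 1 <= kap by rewrite -[leLHS]sqrtr1 ler_sqrt.
have kapk : kap <= k%:R by rewrite -kap2; nra.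
have /choice[f fP] : forall z, exists f : {ffun 'I_k -> 'I_n},
    usparse k z -> [set l | z l != 0]%SET = [set f t | t in 'I_k]%SET.
  move=> z; have [zk|zk] := pselect (usparse k z); last first.
    by exists [ffun=> Ordinal n0].
  have [|f fE] := @exists_enumeration k [set l | z l != 0]%SET _ zk.2.
    apply/negP => /eqP S0; have := zk.1; rewrite big1 => [/esym/eqP|l _].
      by rewrite oner_eq0.
    have /setP/(_ l) := S0; rewrite !inE => /negbFE/eqP ->.
    by rewrite expr0n.
  by exists f.
(* A modulus at most 1 is rounded to at most 4 sqrt k <= 4 k, so the default of [insubd] is never
   taken on unit vectors. *)
pose cd (a : R) : bool * 'I_(4 * k + 1) :=
  (a < 0, insubd (cast_ord (esym (addn1 (4 * k))) ord0) (Num.truncn (4 * kap * `|a|))).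
pose code z : {ffun 'I_k -> 'I_n * (bool * 'I_(4 * k + 1))} :=
  [ffun t => (f z t, cd (z (f z t)))].
pose y i : 'I_n -> R := if pselect (exists z, usparse k z /\ code z = i) is left h
  then projT1 (cid h) else fun=> 0.
have yP i : usparse k (y i) /\ code (y i) = i \/ y i = (fun=> 0).
  by rewrite /y; case: pselect => [h|_]; [left; exact: projT2 (cid h)|right].
have abs1 z l : usparse k z -> `|z l| <= 1.
  case=> z1 _; rewrite -[leRHS]sqrtr1 -sqrtr_sqr ler_sqrt// -z1.
  by rewrite (bigD1 l)//= lerDl sumr_ge0// => *; exact: sqr_ge0.
have cdP (a b : R) : `|a| <= 1 -> `|b| <= 1 -> cd a = cd b ->
    4 * kap * `|a - b| <= 1.
  move=> a1 b1 [ab].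
  have tr (c : R) : `|c| <= 1 -> (Num.truncn (4 * kap * `|c|) < 4 * k + 1)%N.
    move=> c1; rewrite addn1 ltnS truncn_le_nat -[(4 * k).+1%:R]natr1 natrM.
    by have := normr_ge0 c; nra.
  move/(congr1 val); rewrite !val_insubd !tr// => tab.
  have c0 (c : R) : 0 <= 4 * kap * `|c| by rewrite !mulr_ge0//; lra.
  have /andP[ha1 ha2] := truncn_itv (c0 a).
  have /andP[hb1 hb2] := truncn_itv (c0 b).
  rewrite tab in ha1 ha2; move: (Num.truncn _) ha1 ha2 hb1 hb2 {tab} => t.
  rewrite -[t.+1%:R]natr1 => ha1 ha2 hb1 hb2.
  have -> : 4 * kap * `|a - b| = `|4 * kap * `|a| - 4 * kap * `|b| |.
    rewrite -mulrBr normrM [`|4 * kap|]ger0_norm; last by rewrite mulr_ge0//; lra.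
    congr (_ * _); have [a0|a0] := boolP (a < 0).
      have b0 : b < 0 by rewrite -ab.
      by rewrite (ltr0_norm a0) (ltr0_norm b0) -opprD normrN.
    have b0 : 0 <= b by rewrite leNgt -ab.
    by rewrite -leNgt in a0; rewrite (ger0_norm a0) (ger0_norm b0).
  by rewrite ler_norml; apply/andP; split; lra.
exists y; split.
- by move=> i; case: (yP i) => [[[-> _] _]|->] //; rewrite big1// => *; rewrite expr0n.
- move=> i; case: (yP i) => [[h _]|->]; first exact: sparse_l1_le.
  by rewrite big1 ?sqrtr_ge0// => *; rewrite normr0.
move=> z zk; have [z0k z0E] : usparse k (y (code z)) /\ code (y (code z)) = code z.
  by rewrite /y; case: pselect => [h|[]]; [exact: projT2 (cid h)|exists z].
set z0 := y (code z) in z0k z0E *.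
have /ffunP cE := z0E.
have ft t : f z0 t = f z t by have := cE t; rewrite !ffunE => -[].
have ct t : cd (z0 (f z t)) = cd (z (f z t)).
  by have := congr1 snd (cE t); rewrite !ffunE /= ft.
have supp l : z l != 0 -> exists t, l = f z t.
  move=> zl; have : l \in [set l | z l != 0]%SET by rewrite inE.
  by rewrite fP// => /imsetP[t _ ->]; exists t.
have z0_eq0 l : z l = 0 -> z0 l = 0.
  move=> zl; apply/eqP; apply: contraT => z0l.
  have : l \in [set l | z0 l != 0]%SET by rewrite inE.
  rewrite fP// => /imsetP[t _]; rewrite ft => lt.
  have : f z t \in [set l | z l != 0]%SET by rewrite fP//; exact: imset_f.
  by rewrite inE -lt zl eqxx.
exists (code z) => //; rewrite -/z0.
have kpos : 0 < k%:R :> R by rewrite ltr0n.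
apply: (@le_trans _ _ (\sum_l (z l != 0)%:R * (16 * k%:R)^-1)).
  apply: ler_sum => l _; have [zl|zl] := eqVneq (z l) 0.
    by rewrite zl z0_eq0// subr0 expr0n mul0r.
  have [t lt] := supp l zl; rewrite mul1r.
  have : 4 * kap * `|z l - z0 l| <= 1.
    by apply: cdP; rewrite ?abs1// lt ct.
  move=> h; rewrite -[leRHS]mul1r ler_pdivlMr ?mulr_gt0//.
  have -> : (z l - z0 l) ^+ 2 * (16 * k%:R) = (4 * kap * `|z l - z0 l|) ^+ 2.
    by rewrite !exprMn real_normK ?num_real// kap2; ring.
  by rewrite expr_le1// mulr_ge0// mulr_ge0//; lra.
rewrite -mulr_suml.
rewrite sum_indicator.
rewrite ler_pdivrMr ?mulr_gt0// mulrA mulVf ?mul1r ?ler_nat ?zk.2//.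
Qed.

End SparseNet.

(** * From the net to all sparse unit vectors *)

Section NetToSphere.
Context {R : realType} {n : nat}.
Variables (k : nat) (q : ('I_n -> R) -> R) (M e : R) (I : Type) (y : I -> 'I_n -> R).
Hypotheses
  (qZ : forall (c : R) z, q (fun l => c * z l) = c ^+ 2 * q z)
  (q_polar : forall u v, q (fun l => 5 / 2 * u l - 3 / 2 * v l) -
     q (fun l => 3 / 2 * u l - 5 / 2 * v l) = 4 * (q u - q v))
  (q_bounded : forall z, \sum_l z l ^+ 2 = 1 -> `|q z| <= M)
  (y1 : forall i, \sum_l y i l ^+ 2 <= 1)
  (y_net : forall z, usparse k z -> exists2 i, forall l, z l = 0 -> y i l = 0 &
     \sum_l (z l - y i l) ^+ 2 <= 16^-1)
  (qe : forall i, `|q (y i)| <= e).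

(* With D the supremum of |q| over sparse unit vectors and y a net point close
   to z with support inside that of z, polarization gives
   |q z - q y| <= 5/8 D, hence D <= e + 5/8 D. *)
Lemma quadratic_net_bound z : usparse k z -> `|q z| <= 3 * e.
Proof.
move=> zk; pose E : set R := [set `|q z| | z in usparse k].
pose D : R := sup E.
have E0 : E !=set0 by exists `|q z|, z.
have Eub : has_ubound E by exists M => _ [z' [z1 _] <-]; exact: q_bounded.
have qD (z' : 'I_n -> R) : usparse k z' -> `|q z'| <= D.
  by move=> z'k; apply: ub_le_sup => //; exists z'.
have D0 : 0 <= D by exact: le_trans (qD z zk).
have qhom (z' v : 'I_n -> R) : usparse k z' -> (forall l, z' l = 0 -> v l = 0) ->
    `|q v| <= D * \sum_l v l ^+ 2.
  move=> [_ z'k] vz; set N := \sum_l _.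
  have N0 : 0 <= N by apply: sumr_ge0 => l _; exact: sqr_ge0.
  have [N_eq0|N_neq0] := eqVneq N 0.
    have -> : v = (fun l => 0 * v l).
      apply/funext => l; rewrite mul0r; apply/eqP; rewrite -sqrf_eq0; apply/eqP.
      move/eqP: N_eq0; rewrite psumr_eq0; last by move=> *; exact: sqr_ge0.
      by move=> /allP/(_ l (mem_index_enum _))/eqP.
    by rewrite qZ expr0n mul0r normr0 mulr_ge0.
  have N_gt0 : 0 < N by rewrite lt_neqAle eq_sym N_neq0.
  pose r := Num.sqrt N.
  have r2 : r ^+ 2 = N by rewrite sqr_sqrtr.
  have r0 : 0 < r by rewrite sqrtr_gt0.
  have -> : v = (fun l => r * (r^-1 * v l)).
    by apply/funext => l; rewrite mulrA mulfV ?mul1r// gt_eqF.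
  rewrite qZ r2 normrM ger0_norm// mulrC ler_wpM2r// qD//; split.
    under eq_bigr do rewrite exprMn.
    by rewrite -mulr_sumr -/N exprVn r2 mulVf.
  apply: leq_trans z'k; apply/subset_leq_card/fintype.subsetP => l; rewrite !inE.
  by apply: contra => /eqP/vz ->; rewrite mulr0.
suff : D <= e + 5 / 8 * D by have := qD z zk; lra.
apply: ge_sup => // _ [z' z'k <-].
have [i iz' iy] := y_net z'k; have := y1 i; have := qe i => qi yi1.
have h1 := @qhom z' (fun l => 5 / 2 * z' l - 3 / 2 * y i l) z'k.
have h2 := @qhom z' (fun l => 3 / 2 * z' l - 5 / 2 * y i l) z'k.
have {}h1 : `|q (fun l => 5 / 2 * z' l - 3 / 2 * y i l)| <=
   D * \sum_l (5 / 2 * z' l - 3 / 2 * y i l) ^+ 2.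
  by apply: h1 => l zl; rewrite iz'// zl !mulr0 subr0.
have {}h2 : `|q (fun l => 3 / 2 * z' l - 5 / 2 * y i l)| <=
   D * \sum_l (3 / 2 * z' l - 5 / 2 * y i l) ^+ 2.
  by apply: h2 => l zl; rewrite iz'// zl !mulr0 subr0.
set n1 := \sum_l _ in h1; set n2 := \sum_l _ in h2.
have n12 : n1 + n2 <= 5 / 2.
  have -> : n1 + n2 = 15 / 2 * (\sum_l (z' l - y i l) ^+ 2) +
     (\sum_l z' l ^+ 2 + \sum_l y i l ^+ 2).
    by rewrite mulr_sumr -!big_split/=; apply: eq_bigr => l _; field.
  have := z'k.1; lra.
have qd : `|q z' - q (y i)| <= 5 / 8 * D.
  have : `|4 * (q z' - q (y i))| <= D * n1 + D * n2.
    by rewrite -q_polar; apply: (le_trans (ler_normB _ _)); exact: lerD.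
  rewrite normrM ger0_norm// -mulrDr.
  have : D * (n1 + n2) <= D * (5 / 2) by exact: (ler_wpM2l D0 n12).
  lra.
have : `|q z'| <= `|q z' - q (y i)| + `|q (y i)|.
  by have := ler_normD (q z' - q (y i)) (q (y i)); rewrite subrK.
lra.
Qed.

End NetToSphere.

(** * Tail bound for fixed positions *)

Section Core.
Context {R : realType} {m n : nat}.
Variables (s : nat) (d : 'I_m -> 'I_n -> bool).
Local Notation signs := {ffun 'I_m * 'I_n -> bool}.

Lemma psi_lin tau (b : signs) (a c : R) (u v : 'I_n -> R) i :
  psi s d tau b (fun j => a * u j - c * v j) i =
  a * psi s d tau b u i - c * psi s d tau b v i.
Proof.
by rewrite /psi !mulr_sumr -sumrB; apply: eq_bigr => j _; ring.
Qed.

Lemma psi_scale tau (b : signs) (a : R) (u : 'I_n -> R) i :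
  psi s d tau b (fun j => a * u j) i = a * psi s d tau b u i.
Proof.
by rewrite /psi !mulr_sumr; apply: eq_bigr => j _; ring.
Qed.

Lemma chaos_scale (b : signs) (a : R) (u : 'I_n -> R) :
  chaos s d b (fun j => a * u j) = a ^+ 2 * chaos s d b u.
Proof.
rewrite /chaos mulrBr !mulr_sumr; congr (_ - _); apply: eq_bigr => i _.
  by rewrite psi_scale exprMn.
by rewrite exprMn.
Qed.

(** The arguments are 2 (u - v) + (u + v) / 2 and 2 (u - v) - (u + v) / 2, so the difference
    isolates a cross term. The weights 2 and 1/2 suit points of the unit ball at distance 1/4: the
    two squared norms then add up to at most 5/2. *)
Lemma chaos_polar (b : signs) (u v : 'I_n -> R) :
  chaos s d b (fun l => 5 / 2 * u l - 3 / 2 * v l) -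
  chaos s d b (fun l => 3 / 2 * u l - 5 / 2 * v l) =
  4 * (chaos s d b u - chaos s d b v).
Proof.
have sw (a c e f : R) : (a - c) - (e - f) = (a - e) - (c - f) by ring.
rewrite /chaos [LHS]sw [in RHS]sw mulrBr -!sumrB !mulr_sumr.
congr (_ - _); apply: eq_bigr => i _; last by field.
by rewrite !psi_lin; field.
Qed.

(** A crude bound, meant only to make the supremum over sparse unit vectors finite. *)
Lemma chaos_bounded (b : signs) (x : 'I_n -> R) : \sum_j x j ^+ 2 = 1 ->
  `|chaos s d b x| <= m%:R * (((Num.sqrt s%:R)^-1) * n%:R) ^+ 2 + 1.
Proof.
move=> x1.
have xj j : `|x j| <= 1.
  rewrite -[leRHS]sqrtr1 -sqrtr_sqr ler_sqrt// -x1 (bigD1 j)//= lerDl.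
  by apply: sumr_ge0 => *; exact: sqr_ge0.
rewrite /chaos x1 (le_trans (ler_normB _ _))// normr1 lerD2r.
rewrite ger0_norm; last by apply: sumr_ge0 => *; exact: sqr_ge0.
have -> : m%:R * ((Num.sqrt s%:R)^-1 * n%:R) ^+ 2 =
    \sum_(i < m) ((Num.sqrt s%:R)^-1 * n%:R) ^+ 2 :> R.
  by rewrite sumr_const card_ord mulr_natl.
apply: ler_sum => i _; rewrite -real_normK ?num_real//.
apply: lerXn2r; rewrite ?nnegrE ?normr_ge0 ?mulr_ge0 ?invr_ge0 ?sqrtr_ge0//.
rewrite /psi normrM ger0_norm ?invr_ge0 ?sqrtr_ge0//.
rewrite ler_wpM2l ?invr_ge0 ?sqrtr_ge0// (le_trans (ler_norm_sum _ _ _))//.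
have -> : n%:R = \sum_(j < n) 1 :> R by rewrite sumr_const card_ord.
apply: ler_sum => j _; rewrite ffunE mul1r !normrM /sg normr_sign mul1r.
by case: (d i j); rewrite ?normr1 ?mul1r// normr0 mul0r.
Qed.

End Core.

Lemma net_card_le (n k : nat) : (0 < n)%N -> (k <= 2 * n)%N ->
  (n * (2 * (4 * k + 1)) <= (5 * n) ^ 2)%N.
Proof.
move=> n0 kn; rewrite (_ : (5 * n) ^ 2 = n * (25 * n))%N; last by ring.
by rewrite leq_mul2l; apply/orP; right; lia.
Qed.

Lemma rownorm_le (R : realType) (m n s : nat) (d : 'I_m -> 'I_n -> bool)
    (x : 'I_n -> R) t :
  rownorm s d x t <= s%:R^-1 * \sum_j x j ^+ 2.
Proof.
rewrite ler_wpM2l// ler_sum// => j _.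
by case: (d t j); rewrite ?mul1r// mul0r sqr_ge0.
Qed.

(** The factor 144 is 12 from the chaining bound, times 3 for the passage from net to sphere, times
    4 >= e, which lets Markov's inequality at order 2p produce exp (-2p). *)
Lemma chaos_tail (R : realType) (m n s k L p : nat) (d : 'I_m -> 'I_n -> bool)
    (A : 'I_n -> 'I_n -> R) (V eps : R) :
  (0 < n)%N -> (1 < m)%N -> (0 < k)%N -> (k <= 2 * n)%N -> (0 < s)%N ->
  (forall j, (\sum_i d i j)%N = s) ->
  (forall z : 'I_n -> R,
     \sum_j (\sum_l A j l * z l) ^+ 2 = \sum_l z l ^+ 2) ->
  0 < V -> (forall t l, rownorm s d (fun j => A j l) t <= V) ->
  (k <= 2 ^ L)%N -> (0 < p)%N -> ln (5 * n)%:R <= p%:R :> R ->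
  0 < eps -> eps <= 1 ->
  144 * (L.+1 * 2 + 1)%:R * Num.sqrt (32 * p%:R / s%:R +
    96 * (512 * (k%:R * V) * ln m%:R) * ln (5 * n)%:R) <= eps ->
  #|[set b : {ffun 'I_m * 'I_n -> bool} | `[< exists2 z : 'I_n -> R,
       usparse k z &
       eps < `|chaos s d b (fun j => \sum_l A j l * z l)| >]]%SET|%:R
  <= #|{: {ffun 'I_m * 'I_n -> bool}}|%:R * (12 * expR (- (2 * p)%:R)) :> R.
Proof.
move=> n0 m1 k0 kn s0 dcol A_isom V0 AV kL p0.
pose app (z : 'I_n -> R) j := \sum_l A j l * z l.
pose K : R := (L.+1 * 2 + 1)%:R; rewrite -/K.
set l5 := ln (5 * n)%:R => p5 eps0 eps1.
set beta := Num.sqrt _ => small.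
have sR : 0 < s%:R :> R by rewrite ltr0n.
have kR : 0 < k%:R :> R by rewrite ltr0n.
have pR : 0 < p%:R :> R by rewrite ltr0n.
have lm : 0 < ln m%:R :> R by rewrite ln_gt0// ltr1n.
have n5 : (1 < 5 * n)%N by rewrite (@leq_trans (5 * 1))// leq_mul2l n0.
have l50 : 0 < l5 by rewrite ln_gt0// ltr1n.
have kV0 : 0 < k%:R * V by rewrite mulr_gt0.
have c512 : 0 < 512 :> R by rewrite ltr0n.
have c96 : 0 < 96 :> R by rewrite ltr0n.
pose G := 512 * (k%:R * V) * ln m%:R.
have GE : 512 * (k%:R * V) * ln m%:R = G by [].
have G0 : 0 < G := mulr_gt0 (mulr_gt0 c512 kV0) lm.
have b0 : 0 < 32 * p%:R / s%:R + 96 * G * l5.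
  apply: addr_gt0 (mulr_gt0 (mulr_gt0 c96 G0) l50).
  by rewrite divr_gt0// mulr_gt0.
have beta2 : beta ^+ 2 = 32 * p%:R / s%:R + 96 * G * l5 by rewrite sqr_sqrtr ?ltW.
have beta0 : 0 < beta by rewrite sqrtr_gt0.
have expP (a : nat) : expR (a%:R * l5) = ((5 * n) ^ a)%:R :> R.
  by rewrite expRM_natl lnK ?natrX// posrE ltr0n ltnW.
clearbody beta G l5.
have [y [y1 yl1 y_net]] := @sparse_net R n k n0 k0.
pose I : finType := {ffun 'I_k -> 'I_n * (bool * 'I_(4 * k + 1))}.
change (I -> 'I_n -> R) in (type of y).
pose x (i : I) j := \sum_l A j l * y i l.
have x1 i : \sum_j x i j ^+ 2 <= 1 by rewrite A_isom.
have kap0 : 0 < Num.sqrt k%:R :> R by rewrite sqrtr_gt0.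
have /choice[pn pnP] : forall r : nat, exists pi : I -> I,
    (#|[set pi i | i in I]%SET| <= (2 * n + 1) ^ 2 ^ r)%N /\
    forall i t, rownorm s d (fun j => x i j - x (pi i) j) t <= G / (2 ^ r)%:R.
  move=> r; rewrite -GE -[k%:R]sqr_sqrtr ?(ltW kR)//; have [|pi pi1 pi2] :=
      maurey_net kap0 V0 m1 yl1 AV (N := (2 ^ r)%N); first by rewrite expn_gt0.
  by exists pi.
clear GE c512 c96 b0.
(* Past level L the net is all of [I]: since k <= 2^L, its size (at most (5n)^(2k)) still obeys the
   bound (5n)^(2^(L+1)), and the chain ends at the identity. *)
pose pi r := if (r <= L)%N then pn r else id.
have two0 r : 0 < (2 ^ r)%:R :> R by rewrite ltr0n expn_gt0.
have pi_row r i t : rownorm s d (fun j => x i j - x (pi r i) j) t <=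
    G / (2 ^ r)%:R.
  rewrite /pi; case: ifP => _.
    exact: (pnP r).2.
  rewrite /rownorm big1 => [|j _]; last by rewrite subrr expr0n mulr0.
  by rewrite mulr0 divr_ge0 ?mulr_ge0 ?(ltW G0).
have pi_card r : (r <= L.+1)%N ->
    (#|[set pi r i | i in I]%SET| <= (5 * n) ^ (2 ^ r))%N.
  move=> rL; rewrite /pi; case: ifP => [_|/negbT].
    apply: leq_trans (pnP r).1 _; rewrite leq_exp2r ?expn_gt0//.
    by rewrite (mulnDl 2 3) leq_add2l muln_gt0.
  rewrite -ltnNge => Lr; have -> : r = L.+1 by apply/eqP; rewrite eqn_leq rL.
  apply: leq_trans (max_card _) _.
  rewrite card_ffun !card_prod card_bool !card_ord.
  apply: (@leq_trans (((5 * n) ^ 2) ^ k)).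
    by rewrite leq_exp2r// net_card_le.
  by rewrite -expnM leq_exp2l// expnS leq_mul2l.
(* Pairs of consecutive net points number at most (5n)^(2^(r+1) + 2^r), below (5n)^(2^(r+2)). In
   [rho2], 4 / s comes from squared distances at most 4, and 6 G / 2^(r+1) from the triangle
   inequality through x i. Pairing p with the first and the entropy with the second yields the two
   terms 32 p / s and 96 G l5 of beta^2. *)
pose P r : R := if r is r'.+1 then p%:R + (2 ^ r'.+2)%:R * l5 else p%:R + l5.
pose rho2 r : R := if r is r'.+1
  then Num.min (4 / s%:R) (6 * G / (2 ^ r'.+1)%:R) else s%:R^-1.
have H := @avg_max_chaos R m n s d s0 dcol I x x1 L.+1 pi P rho2 beta p.
have {}H : avg (fun b => max_chaos s d x b ^+ (2 * p)) <=
    12 * (12 * K * beta) ^+ (2 * p).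
  apply: H => //.
  - by move=> i; rewrite /pi ltnn.
  - by case=> [|r] _ /=; rewrite lerDl ?mulr_ge0// ltW.
  - case=> [|r] /=; first by rewrite invr_ge0 ltW.
    by rewrite le_min !divr_ge0 ?mulr_ge0 ?(ltW G0).
  - case=> [|r] _ /=; rewrite beta2.
      have : 0 < 96 * G * l5 by apply: mulr_gt0 => //; apply: mulr_gt0; rewrite // ltr0n.
      have : 8 * (p%:R + l5) / s%:R <= 32 * p%:R / s%:R.
        by rewrite ler_pM2r ?invr_gt0//; clear - p5 pR; lra.
      by clear; lra.
    set mn := Num.min _ _.
    have h1 : p%:R * mn <= p%:R * (4 / s%:R).
      by rewrite ler_pM2l// ge_min lexx.
    have h2 : (2 ^ r.+2)%:R * l5 * mn <=
        (2 ^ r.+2)%:R * l5 * (6 * G / (2 ^ r.+1)%:R).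
      by rewrite ler_pM2l ?mulr_gt0// ge_min lexx orbT.
    have h3 : (2 ^ r.+2)%:R * l5 * (6 * G / (2 ^ r.+1)%:R) = 12 * G * l5.
      by rewrite (expnS 2 r.+1) natrM; field; rewrite gt_eqF.
    rewrite h3 in h2.
    have -> : 32 * p%:R / s%:R = 8 * (p%:R * (4 / s%:R)) :> R by clear; ring.
    by clear - h1 h2; lra.
  - apply: (@le_trans _ _ (expR (1%:R * l5))); last first.
      by rewrite ler_expR /= mul1r lerDr.
    by rewrite expP ler_nat; exact: pi_card.
  - move=> r rL /=.
    apply: (@le_trans _ _ (expR ((2 ^ r.+2)%:R * l5))); last first.
      by rewrite ler_expR lerDr.
    rewrite expP ler_nat.
    apply: leq_trans (_ : #|finset.setX [set pi r.+1 i | i in I]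
       [set pi r i | i in I]| <= _)%N.
      apply/subset_leq_card/fintype.subsetP => _ /imsetP[i _ ->].
      by rewrite inE /= !imset_f.
    rewrite cardsX; apply: leq_trans (leq_mul (pi_card _ _) (pi_card _ _)) _ => //.
      exact: ltnW.
    by rewrite -expnD leq_exp2l// (expnS 2 r.+1) mul2n -addnn leq_add2l leq_exp2l.
  - move=> i t; apply: le_trans (rownorm_le _ _ _ _) _.
    by rewrite /= -[leRHS]mulr1 ler_wpM2l.
  - move=> r i t rL /=; rewrite le_min; apply/andP; split.
      apply: le_trans (rownorm_le _ _ _ _) _; rewrite mulrC ler_pM2r ?invr_gt0//.
      apply: (@le_trans _ _ (2 * \sum_j x (pi r.+1 i) j ^+ 2 +
         2 * \sum_j x (pi r i) j ^+ 2)).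
        rewrite !mulr_sumr -big_split; apply: ler_sum => j _ /=.
        by have := sqr_ge0 (x (pi r.+1 i) j + x (pi r i) j); clear; nra.
      by have := x1 (pi r.+1 i); have := x1 (pi r i); clear; lra.
    rewrite rownormE.
    have w0 j : 0 <= s%:R^-1 * (d t j)%:R :> R by rewrite mulr_ge0.
    apply: le_trans (wnormB_le _ _ (x i) w0) _.
    have sym r' : wnorm (fun j => s%:R^-1 * (d t j)%:R)
       (fun j => x (pi r' i) j - x i j) <= G / (2 ^ r')%:R.
      apply: le_trans (pi_row r' i t); rewrite rownormE le_eqVlt; apply/orP; left.
      by apply/eqP; apply: eq_bigr => j _; rewrite -sqrrN opprB.
    have := sym r; have := sym r.+1.
    have -> : G / (2 ^ r)%:R = 2 * G / (2 ^ r.+1)%:R.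
      by rewrite (expnS 2 r) natrM; field; rewrite gt_eqF.
    by clear; lra.
  (* By [small], 12 K beta <= eps / 12 <= 1/12; as p >= 1, the contraction factor is at most 6 /
     144. *)
  have Kb : 0 <= 12 * K * beta <= 12^-1.
    by rewrite !mulr_ge0 ?(ltW beta0)//=; clear - small eps1; lra.
  rewrite (_ : (12 * _ * beta) = 12 * K * beta)//.
  case/andP: Kb => Kb0 Kb1.
  have : (12 * K * beta) ^+ (2 * p) <= (12 * K * beta) ^+ 2.
    by rewrite ler_wiXn2l//; [clear - Kb1; lra|rewrite -[X in (X <= _)%N](muln1 2) leq_mul2l].
  by clear - Kb0 Kb1; nra.
pose e3 := eps / 3.
have e30 : 0 < e3 by rewrite divr_gt0.
have bad_sub : ([set b : {ffun 'I_m * 'I_n -> bool} | `[< exists2 z : 'I_n -> R, usparse k z &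
       eps < `|chaos s d b (app z)| >]] \subset
   [set b | e3 ^+ (2 * p) <= max_chaos s d x b ^+ (2 * p)])%SET.
  apply/fintype.subsetP => b; rewrite !finset.in_set => /asboolP[z zk zeps].
  have X0 : 0 <= max_chaos s d x b by exact: max_chaos_ge0.
  apply: (lerXn2r (2 * p) (ltW e30) X0); rewrite leNgt.
  apply/negP => Xlt; have : `|chaos s d b (app z)| <= 3 * e3.
    apply: (@quadratic_net_bound R n k (fun z => chaos s d b (app z))
      (m%:R * (((Num.sqrt s%:R)^-1) * n%:R) ^+ 2 + 1) e3 I y) => //.
    - move=> c u; rewrite -chaos_scale; congr chaos; apply/funext => j.
      by rewrite mulr_sumr; apply: eq_bigr => l _; rewrite mulrCA.
    - move=> u v; rewrite -chaos_polar.
      have lin (a c : R) : app (fun l => a * u l - c * v l) =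
          (fun j => a * app u j - c * app v j).
        apply/funext => j; rewrite /app !mulr_sumr -sumrB.
        by apply: eq_bigr => l _; clear; ring.
      by rewrite !lin.
    - by move=> u u1; apply: chaos_bounded; rewrite A_isom.
    move=> i; apply: ltW; apply: le_lt_trans Xlt.
    exact: (le_bigmax 0 (fun i => `|chaos s d b (x i)|)).
  by rewrite /e3; clear - zeps; lra.
have e2p : 0 < e3 ^+ (2 * p) by rewrite exprn_gt0.
apply: (@le_trans _ _ (#|[set b | e3 ^+ (2 * p) <=
    max_chaos s d x b ^+ (2 * p)]%SET|%:R)).
  by rewrite ler_nat; exact: subset_leq_card.
apply: le_trans (avg_markov e2p _) _.
  by move=> b; rewrite exprn_ge0// max_chaos_ge0.
rewrite ler_wpM2l// ler_pdivrMr//; apply: le_trans H _.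
rewrite -[leRHS]mulrA ler_wpM2l//.
have -> : expR (- (2 * p)%:R) = (expR (- 1)) ^+ (2 * p) :> R.
  by rewrite -expRM_natl mulrN1.
have Kb0 : 0 <= 12 * K * beta by rewrite mulr_ge0 ?(ltW beta0)// mulr_ge0.
have ee0 : 0 <= expR (-1) * e3 by rewrite mulr_ge0 ?expR_ge0// ltW.
rewrite -exprMn; apply: (lerXn2r (2 * p) Kb0 ee0).
have : 4^-1 <= expR (- 1) :> R.
  rewrite expRN lef_pV2 ?posrE ?expR_gt0//.
  by have := @expR_le_quadratic R 1 (lexx 1); clear; lra.
by rewrite /e3; clear - small eps0; nra.
Qed.

(** * Column weights *)

Section ColumnChernoff.
Context {R : realType}.
Variables (m n : nat) (mu : 'I_n -> {ffun 'I_m -> bool} -> R) (q : R).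
Hypotheses (mu0 : forall j e, 0 <= mu j e)
  (mu1 : forall j, \sum_e mu j e <= 1)
  (muq : forall j i, \sum_e mu j e * (e i)%:R <= q).
Local Notation config := {ffun 'I_n -> {ffun 'I_m -> bool}}.

(** A Chernoff bound from the marginals alone: exp y <= 1 + 3 y on [0, 1] bounds the factor of
    column j by 1 + 3 lambda q a_j, and the a_j add up to 1. The condition lambda * a j <= 1 keeps y
    in that range. *)
Lemma column_chernoff (i : 'I_m) (a : 'I_n -> R) (lambda t : R) :
  0 <= lambda -> (forall j, 0 <= a j) -> (forall j, lambda * a j <= 1) ->
  \sum_j a j = 1 ->
  \sum_(c : config | t < \sum_j (c j i)%:R * a j) \prod_j mu j (c j)
    <= expR (3 * lambda * q - lambda * t).
Proof.
move=> l0 a0 la a1.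
have prod0 (c : config) : 0 <= \prod_j mu j (c j) by exact: prodr_ge0.
apply: (@le_trans _ _ (expR (- (lambda * t)) * \sum_(c : config)
    \prod_j (mu j (c j) * expR (lambda * ((c j i)%:R * a j))))).
  rewrite mulr_sumr big_mkcond/=; apply: ler_sum => c _.
  rewrite big_split/= -expR_sum -mulr_sumr mulrCA -expRD.
  case: ifP => [tc|_]; last by rewrite mulr_ge0 ?expR_ge0.
  by rewrite ler_peMr// -[leLHS]expR0 ler_expR addrC -mulrBr mulr_ge0// subr_ge0 ltW.
rewrite addrC expRD ler_wpM2l ?expR_ge0//.
rewrite -(bigA_distr_bigA (fun j e => mu j e * expR (lambda * ((e i)%:R * a j)))).
have -> : expR (3 * lambda * q) = \prod_j expR (3 * lambda * q * a j).
  by rewrite -expR_sum -mulr_sumr a1 mulr1.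
apply: ler_prod => j _; apply/andP; split.
  by apply: sumr_ge0 => e _; rewrite mulr_ge0 ?expR_ge0.
apply: le_trans (expR_ge1Dx _).
apply: (@le_trans _ _ (\sum_e (mu j e + 3 * lambda * a j * (mu j e * (e i)%:R)))).
  apply: ler_sum => e _.
  have h : expR (lambda * ((e i)%:R * a j)) <= 1 + 3 * lambda * a j * (e i)%:R.
    case: (e i); last by rewrite mul0r !mulr0 expR0 addr0.
    rewrite mul1r mulr1 -mulrA expR_le1D3x// la mulr_ge0//.
  apply: le_trans (ler_wpM2l (mu0 j e) h) _.
  by rewrite mulrDr mulr1 mulrCA.
rewrite big_split/= -mulr_sumr lerD// -!mulrA ler_wpM2l// ler_wpM2l// mulrC.
by rewrite ler_wpM2r.
Qed.

Lemma column_chernoff_union (a : 'I_n -> 'I_n -> R) (lambda t : R) :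
  0 <= lambda -> (forall l j, 0 <= a l j) -> (forall l j, lambda * a l j <= 1) ->
  (forall l, \sum_j a l j = 1) ->
  \sum_(c : config | [exists i, exists l, t < \sum_j (c j i)%:R * a l j])
     \prod_j mu j (c j)
    <= m%:R * n%:R * expR (3 * lambda * q - lambda * t).
Proof.
move=> l0 a0 la a1.
have prod0 (c : config) : 0 <= \prod_j mu j (c j) by exact: prodr_ge0.
apply: (@le_trans _ _ (\sum_(i : 'I_m) \sum_(l : 'I_n)
    \sum_(c : config | t < \sum_j (c j i)%:R * a l j) \prod_j mu j (c j))).
  under [leRHS]eq_bigr do under eq_bigr do rewrite big_mkcond/=.
  under [leRHS]eq_bigr do rewrite exchange_big/=.
  rewrite exchange_big/= big_mkcond/=; apply: ler_sum => c _.
  pose F i l := if t < \sum_j (c j i)%:R * a l j then \prod_j mu j (c j) else 0.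
  have F0 i l : 0 <= F i l by rewrite /F; case: ifP.
  rewrite -[leRHS]/(\sum_i \sum_l F i l).
  case: ifP => [/existsP[i /existsP[l tl]]|_]; last first.
    by apply: sumr_ge0 => i _; apply: sumr_ge0 => l _.
  have -> : \prod_j mu j (c j) = F i l by rewrite /F tl.
  rewrite (bigD1 i)//= (bigD1 l)//= -addrA lerDl addr_ge0// sumr_ge0//.
  by move=> i' _; apply: sumr_ge0 => l' _.
apply: (@le_trans _ _ (\sum_(i : 'I_m) \sum_(l : 'I_n)
    expR (3 * lambda * q - lambda * t))).
  apply: ler_sum => i _; apply: ler_sum => l _.
  exact: column_chernoff.
by rewrite !sumr_const !card_ord -mulrnA -natrM [leRHS]mulr_natl mulnC.
Qed.

End ColumnChernoff.

(** * Transfer to the probability space *)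

Section FiniteEvents.
Context {R : realType} {d : measure_display} {Omega : measurableType d}.
Variable P : probability Omega R.

Lemma prob_bigsetU (T : choiceType) (F : T -> set Omega) (r : seq T) :
  (forall t, measurable (F t)) ->
  (forall t t' w, F t w -> F t' w -> t = t') -> uniq r ->
  P (\big[setU/set0]_(t <- r) F t) = (\sum_(t <- r) P (F t))%E.
Proof.
move=> mF dF; elim: r => [|t r IH] /=; first by rewrite !big_nil measure0.
move=> /andP[tr ur]; rewrite !big_cons measureU//; last 2 first.
- exact: bigsetU_measurable.
- apply/seteqP; split=> // w [Ftw]; rewrite -bigcup_seq => -[t' t'r Ft'w].
  by move: tr; rewrite (dF _ _ _ Ftw Ft'w) t'r.
by congr (_ + _)%E; exact: IH.
Qed.

Lemma sum_prob_le (T : finType) (Q : pred T) (F : T -> set Omega) (B : set Omega) :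
  (forall t, measurable (F t)) -> measurable B ->
  (forall t t' w, F t w -> F t' w -> t = t') ->
  (forall t, Q t -> F t `<=` B) ->
  (\sum_(t | Q t) P (F t) <= P B)%E.
Proof.
move=> mF mB dF FB; rewrite -big_filter.
rewrite -prob_bigsetU// ?filter_uniq ?index_enum_uniq//.
apply: le_measure; rewrite ?inE//; first exact: bigsetU_measurable.
rewrite -bigcup_seq => w [t /=]; rewrite mem_filter => /andP[Qt _] Ftw.
exact: FB Ftw.
Qed.

Lemma prob_le_sum (T : finType) (Q : pred T) (F : T -> set Omega) (B N : set Omega) :
  (forall t, measurable (F t)) -> measurable B -> P.-negligible N ->
  (forall w, B w -> N w \/ exists2 t, Q t & F t w) ->
  (P B <= \sum_(t | Q t) P (F t))%E.
Proof.
move=> mF mB [N' [mN' N'0 NN']] BF.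
have le_big (r : seq T) : (P (\big[setU/set0]_(t <- r | Q t) F t) <=
    \sum_(t <- r | Q t) P (F t))%E.
  elim: r => [|t r IH]; first by rewrite !big_nil measure0.
  rewrite !big_cons; case: ifP => // Qt.
  apply: le_trans (measureU2 _ _ _) _ => //; first exact: bigsetU_measurable.
  exact: leeD.
apply: le_trans (le_big (index_enum T)).
rewrite -[leRHS]add0e -N'0.
apply: le_trans (measureU2 _ mN' _); last exact: bigsetU_measurable.
apply: le_measure; rewrite ?inE//.
  by apply: measurableU => //; exact: bigsetU_measurable.
move=> w /BF[/NN'|[t Qt Ftw]]; first by left.
by right; rewrite -bigcup_seq_cond; exists t => //=; rewrite mem_index_enum.
Qed.

Lemma sigma_bigcap_fin (G : set (set Omega)) (I : finType) (F : I -> set Omega) :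
  (forall i, <<s G >> (F i)) -> <<s G >> (\bigcap_i F i).
Proof.
move=> GF.
apply: (@fin_bigcap_measurable _ (g_sigma_algebraType G) I setT F) => [|i _].
  exact: finite_finset.
exact: GF.
Qed.

Lemma sigma_RV_preimage (I : Type) (X : I -> {RV P >-> R}) i (B : set R) :
  measurable B -> sigma_RV X (X i @^-1` B).
Proof.
move=> mB; apply: sub_sigma_algebra; exists i => //.
by exists B => //; rewrite setTI.
Qed.

End FiniteEvents.

Lemma set_of_setT (T : finType) : [set` [set: T]%SET] = [set: T].
Proof. by apply/seteqP; split => // x _ /=; rewrite finset.in_setT. Qed.

Section SJLTConfigurations.
Context {R : realType} {d : measure_display} {Omega : measurableType d}.
Variables (P : probability Omega R) (m n s : nat).
Variables sigma delta : 'I_m -> 'I_n -> {RV P >-> R}.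
Hypothesis sj : sjlt_data s sigma delta.
Local Notation signs := {ffun 'I_m * 'I_n -> bool}.
Local Notation config := {ffun 'I_n -> {ffun 'I_m -> bool}}.

Definition sign_event (b : signs) : set Omega :=
  \bigcap_(ij : 'I_m * 'I_n) (sigma ij.1 ij.2 @^-1` [set sg (b ij)]).

Definition column_event (j : 'I_n) (e : {ffun 'I_m -> bool}) : set Omega :=
  \bigcap_(i : 'I_m) (delta i j @^-1` [set (e i)%:R]).

Definition config_event (c : config) : set Omega :=
  \bigcap_(j : 'I_n) column_event j (c j).

Definition column_prob j e : R := fine (P (column_event j e)).

Let mset1 (X : {RV P >-> R}) (r : R) : measurable (X @^-1` [set r]).
Proof. by apply: measurable_funPTI; exact: measurable_set1. Qed.

Lemma measurable_sign_event b : measurable (sign_event b).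
Proof.
by apply: fin_bigcap_measurable => [|ij _]; [exact: finite_finset|exact: mset1].
Qed.

Lemma measurable_column_event j e : measurable (column_event j e).
Proof.
by apply: fin_bigcap_measurable => [|i _]; [exact: finite_finset|exact: mset1].
Qed.

Lemma measurable_config_event c : measurable (config_event c).
Proof.
apply: fin_bigcap_measurable => [|i _]; first exact: finite_finset.
exact: measurable_column_event.
Qed.

Lemma prob_sign_event b : P (sign_event b) = (#|{: signs}|%:R^-1)%:E.
Proof.
have h := sjlt_sigma_indep sj (K := [set: 'I_m * 'I_n]%SET)
  (E := fun ij => sigma ij.1 ij.2 @^-1` [set sg (b ij)]).
rewrite set_of_setT in h; rewrite [LHS]h; last first.
  move=> ij _; apply: (@sigma_RV_preimage _ _ _ _ _ (fun _ : unit => sigma ij.1 ij.2) tt).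
  exact: measurable_set1.
rewrite (eq_bigr (fun=> (2^-1)%:E)); last first.
  move=> ij _; have [h1 h2] := sjlt_sigma_rademacher sj ij.1 ij.2.
  by rewrite /sg; case: (b ij); rewrite ?expr1 ?expr0.
rewrite prodEFin prodr_const cardsT card_ffun card_bool natrX exprVn.
by rewrite card_prod.
Qed.

Lemma prob_column_event j e : P (column_event j e) = (column_prob j e)%:E.
Proof.
by rewrite fineK// fin_num_measure//; exact: measurable_column_event.
Qed.

Lemma column_event_sigma j e :
  sigma_RV (fun i : 'I_m => delta i j) (column_event j e).
Proof.
apply: sigma_bigcap_fin => i.
apply: (@sigma_RV_preimage _ _ _ _ _ (fun i : 'I_m => delta i j) i).
exact: measurable_set1.
Qed.

Lemma prob_config_event c :
  P (config_event c) = (\prod_j column_prob j (c j))%:E.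
Proof.
have h := sjlt_columns_indep sj (K := [set: 'I_n]%SET)
  (E := fun j => column_event j (c j)).
rewrite set_of_setT in h; rewrite [LHS]h; last by move=> j _; exact: column_event_sigma.
rewrite -prodEFin; apply: eq_big => [j|j _]; first by rewrite finset.in_setT.
exact: prob_column_event.
Qed.

Lemma prob_sign_config_event b c :
  P (sign_event b `&` config_event c) =
  (#|{: signs}|%:R^-1 * \prod_j column_prob j (c j))%:E.
Proof.
rewrite (sjlt_delta_sigma_indep sj); first last.
- apply: sigma_bigcap_fin => j; apply: sigma_bigcap_fin => i.
  apply: (@sigma_RV_preimage _ _ _ _ _
    (fun ij : 'I_m * 'I_n => delta ij.1 ij.2) (i, j)).
  exact: measurable_set1.
- apply: sigma_bigcap_fin => ij.
  apply: (@sigma_RV_preimage _ _ _ _ _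
    (fun ij : 'I_m * 'I_n => sigma ij.1 ij.2) ij).
  exact: measurable_set1.
by rewrite prob_sign_event prob_config_event EFinM.
Qed.

Lemma natr_bool_inj : injective (fun e : bool => e%:R : R).
Proof.
by move=> [] [] //= /eqP; rewrite ?oner_eq0// eq_sym oner_eq0.
Qed.

Lemma column_event_inj j e e' w :
  column_event j e w -> column_event j e' w -> e = e'.
Proof.
move=> h h'; apply/ffunP => i; apply: natr_bool_inj.
by have /= <- := h i I; have /= <- := h' i I.
Qed.

Lemma column_prob_ge0 j e : 0 <= column_prob j e.
Proof. exact/fine_ge0/measure_ge0. Qed.

(** The inequality is all that the Chernoff bound asks for, so values of delta outside {0, 1} need
    no treatment here. *)
Lemma sum_column_prob j : \sum_e column_prob j e <= 1.
Proof.
rewrite -lee_fin -sumEFin.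
under eq_bigr do rewrite -prob_column_event.
rewrite -(@probability_setT _ _ _ P); apply: sum_prob_le => //.
- exact: measurable_column_event.
- exact: column_event_inj.
Qed.

(** The correlation bound for a singleton gives the marginal, because a 0-1 variable agrees almost
    everywhere with the indicator of its value 1. *)
Lemma prob_delta1 i j : (P (delta i j @^-1` [set 1%R]) <= (s%:R / m%:R)%:E)%E.
Proof.
have := sjlt_neg_corr sj j [set i]%SET; rewrite cards1 expr1.
apply: le_trans; rewrite unlock /=.
under eq_integral do rewrite big_set1.
have mA := mset1 (delta i j) 1.
rewrite -[X in (P X <= _)%E]setIT -(integral_indic P measurableT mA).
rewrite le_eqVlt; apply/orP; left; apply/eqP.
apply: ae_eq_integral => //.
- by apply/measurable_EFinP; exact: measurable_indic.
- by apply/measurable_EFinP; exact: measurable_funP.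
have := sjlt_delta01 sj i j; apply: filterS => w dw _ /=; rewrite indicE.
case: dw => dw; rewrite dw; first by rewrite memNset//= dw => /esym/eqP; rewrite oner_eq0.
by rewrite mem_set.
Qed.

Lemma sum_column_prob_row j i :
  \sum_e column_prob j e * (e i)%:R <= s%:R / m%:R.
Proof.
rewrite -lee_fin; apply: le_trans (prob_delta1 i j).
have -> : \sum_e column_prob j e * (e i)%:R =
    \sum_(e : {ffun 'I_m -> bool} | e i) column_prob j e.
  by rewrite [RHS]big_mkcond; apply: eq_bigr => e _; case: (e i); rewrite ?mulr1 ?mulr0.
rewrite -sumEFin; under eq_bigr do rewrite -prob_column_event.
apply: sum_prob_le => //.
- exact: measurable_column_event.
- exact: column_event_inj.
by move=> e ei w /(_ i I) /=; rewrite ei.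
Qed.

(** The two masses given by [rademacher] add up to 1, so all other values of a sign form a null set;
    finitely many null sets are then discarded. *)
Lemma ae_regular : {ae P, forall w, exists b c,
  [/\ sign_event b w, config_event c w &
      forall j, (\sum_i c j i)%N = s]}.
Proof.
have sig ij : {ae P, forall w, sigma ij.1 ij.2 w = 1 \/ sigma ij.1 ij.2 w = -1}.
  have [h1 h2] := sjlt_sigma_rademacher sj ij.1 ij.2.
  have m1 := mset1 (sigma ij.1 ij.2) 1; have m2 := mset1 (sigma ij.1 ij.2) (-1).
  exists (~` (sigma ij.1 ij.2 @^-1` [set 1] `|` sigma ij.1 ij.2 @^-1` [set -1])).
  split => //; first by apply: measurableC; exact: measurableU.
  have PU : P (sigma ij.1 ij.2 @^-1` [set 1] `|` sigma ij.1 ij.2 @^-1` [set -1])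
      = ((2^-1)%:E + (2^-1)%:E)%E.
    rewrite -{1}h1 -h2; apply: measureU => //.
    apply/seteqP; split => // w [/= -> /eqP]; rewrite -subr_eq0 opprK.
    by rewrite -[1 + 1]/(2%:R) pnatr_eq0.
  rewrite probability_setC; last exact: measurableU.
  have half : 2^-1 + 2^-1 = 1 :> R by field.
  rewrite -EFinD half in PU.
  by rewrite PU; exact: subee.
have hs := filter_forall (F := almost_everywhere P) _ sig.
have hd := filter_forall (F := almost_everywhere P) _
  (fun ij : 'I_m * 'I_n => sjlt_delta01 sj ij.1 ij.2).
have hc := filter_forall (F := almost_everywhere P) _ (sjlt_column_sparsity sj).
apply: filterS3 (hs _) (hd _) (hc _) => w {}hs {}hd {}hc.
exists [ffun ij => sigma ij.1 ij.2 w == -1].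
exists [ffun j => [ffun i => delta i j w == 1]]; split.
- move=> ij _ /=; rewrite ffunE /sg; case: (hs ij) => ->; rewrite ?eqxx ?expr1//.
  by rewrite -subr_eq0 opprK -[1 + 1]/(2%:R) pnatr_eq0.
- move=> j _ i _ /=; rewrite !ffunE; case: (hd (i, j)) => /= ->; rewrite ?eqxx//.
  by rewrite eq_sym oner_eq0.
move=> j; rewrite -(hc j) -sum1dep_card [RHS]big_mkcond/=; apply: eq_bigr => i _.
by rewrite !ffunE; case: (delta i j w == 1).
Qed.

(* E is contained, up to a null set, in the union of the atoms {(b, c)} of bad
   configurations; W collects the columns for which no bound on the signs is
   available. *)
Lemma prob_le_configurations (E : set Omega) (bad : signs -> config -> bool)
    (W : pred config) (e1 e2 : R) :
  measurable E -> 0 <= e1 ->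
  (forall w b c, E w -> sign_event b w -> config_event c w ->
     (forall j, (\sum_i c j i)%N = s) -> bad b c) ->
  (forall c : config, (forall j, (\sum_i c j i)%N = s) -> ~~ W c ->
     #|[set b | bad b c]%SET|%:R <= #|{: signs}|%:R * e1) ->
  \sum_(c : config | W c) \prod_j column_prob j (c j) <= e2 ->
  (P E <= (e1 + e2)%:E)%E.
Proof.
move=> mE e10 Ebad badle We2.
pose col (c : config) := [forall j, (\sum_i c j i)%N == s].
have [N [mN N0 NE]] := ae_regular.
pose F (bc : signs * config) := sign_event bc.1 `&` config_event bc.2.
have mF bc : measurable (F bc).
  by apply: measurableI; [exact: measurable_sign_event|exact: measurable_config_event].
apply: le_trans (_ : _ <= \sum_(bc | bad bc.1 bc.2 && col bc.2) P (F bc))%E _.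
  apply: (@prob_le_sum _ _ _ _ _ _ _ _ N) => //; first by exists N; split.
  move=> w Ew; have [Nw|Nw] := pselect (N w); [by left|right].
  have [b [c [bw cw sc]]] : exists b c, [/\ sign_event b w, config_event c w &
      forall j, (\sum_i c j i)%N = s].
    by apply: contrapT => nw; apply: Nw; exact: NE.
  exists (b, c) => //=; rewrite (Ebad w b c)//=.
  by apply/forallP => j; rewrite sc.
rewrite (eq_bigr (fun bc : signs * config =>
  (#|{: signs}|%:R^-1 * \prod_j column_prob j (bc.2 j))%:E)); last first.
  by move=> bc _; exact: prob_sign_config_event.
rewrite sumEFin lee_fin.
have S0 : 0 < #|{: signs}|%:R :> R by rewrite ltr0n card_signs_gt0.
have pr0 (c : config) : 0 <= \prod_j column_prob j (c j).
  by apply: prodr_ge0 => j _; exact: column_prob_ge0.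
apply: (@le_trans _ _ (\sum_(c : config)
   (e1 * \prod_j column_prob j (c j) +
    (if W c then \prod_j column_prob j (c j) else 0)))); last first.
  rewrite big_split/= -mulr_sumr -big_mkcond/= lerD//.
  rewrite -[leRHS]mulr1 ler_wpM2l//.
  rewrite -(bigA_distr_bigA (fun j e => column_prob j e)).
  apply: prodr_ile1 => j _; rewrite sum_column_prob andbT.
  by apply: sumr_ge0 => e _; exact: column_prob_ge0.
rewrite big_mkcond/= sum_pair exchange_big/=; apply: ler_sum => c _.
rewrite -big_mkcond/=.
have [cc|ncc] := boolP (col c); last first.
  rewrite big_pred0 => [|b]; last by rewrite andbF.
  by rewrite addr_ge0 ?mulr_ge0//; case: ifP.
under eq_bigl do rewrite andbT.
rewrite sumr_const -[leLHS]mulr_natl mulrA.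
have sc j : (\sum_i c j i)%N = s by apply/eqP; move/forallP: cc.
have [Wc|nWc] := boolP (W c).
  apply: le_trans (_ : 1 * \prod_j column_prob j (c j) <= _).
    by rewrite ler_wpM2r// ler_pdivrMr// mul1r ler_nat max_card.
  by rewrite mul1r lerDr mulr_ge0.
rewrite addr0 ler_wpM2r// ler_pdivrMr// mulrC.
by apply: le_trans (badle c sc nWc); rewrite cardsE.
Qed.

End SJLTConfigurations.

(** * Measurability of the isometry event *)

Section RationalDensity.
Context {R : realType} {n : nat}.

(** A negative value would persist at a rational vector close to z. Zero coordinates are rounded to
    zero, so the support does not grow. *)
Lemma quadratic_form_rational_ge0 (k : nat) (H : 'I_n -> 'I_n -> R)
    (z : 'I_n -> R) :
  (#|[set l | (z l != 0)%R]%SET| <= k)%N ->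
  (forall q : {ffun 'I_n -> rat}, (#|[set l | (q l != 0)%R]%SET| <= k)%N ->
     0 <= \sum_l \sum_l' H l l' * (ratr (q l) * ratr (q l'))) ->
  0 <= \sum_l \sum_l' H l l' * (z l * z l').
Proof.
move=> zk Hq; rewrite leNgt; apply/negP => hneg.
pose S : R := \sum_l \sum_l' `|H l l'|.
pose Y : R := \sum_l `|z l|.
have S0 : 0 <= S by apply: sumr_ge0 => l _; apply: sumr_ge0 => l' _.
have Y0 : 0 <= Y by apply: sumr_ge0 => l _.
have zY l : `|z l| <= Y by rewrite /Y (bigD1 l)//= lerDl sumr_ge0.
move: hneg; set h := \sum_l _ => hneg.
(* Rounding within tau raises the form by at most S (2 Y + 1) tau; the extra 1 in the denominator
   keeps the result strictly negative. *)
pose tau := Num.min 1 (- h / (S * (2 * Y + 1) + 1)).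
have den0 : 0 < S * (2 * Y + 1) + 1 by rewrite ltr_wpDl// mulr_ge0// addr_ge0// mulr_ge0.
have tau0 : 0 < tau by rewrite lt_min ltr01 divr_gt0// oppr_gt0.
have tau1 : tau <= 1 by rewrite ge_min lexx.
have tauh : tau * (S * (2 * Y + 1) + 1) <= - h.
  by rewrite -ler_pdivlMr// ge_min lexx orbT.
have /choice[q qP] : forall l, exists q : rat,
    (z l = 0 -> q = 0) /\ `|z l - ratr q| <= tau.
  move=> l; have [z0|z0] := eqVneq (z l) 0.
    by exists 0; split=> //; rewrite z0 rmorph0 subrr normr0 ltW.
  have [|q] := @rat_in_itvoo R (z l - tau) (z l + tau); first by rewrite ltrBlDr -addrA ltrDl addr_gt0.
  rewrite in_itv/= => /andP[q1 q2]; exists q; split.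
    by move=> zl0; rewrite zl0 eqxx in z0.
  by rewrite ler_norml; apply/andP; split; rewrite ltW//; lra.
have qk : (#|[set l | ([ffun l => q l] l != 0)%R]%SET| <= k)%N.
  apply: leq_trans zk; apply/subset_leq_card/fintype.subsetP => l.
  rewrite !finset.in_set ffunE; apply: contra => /eqP zl; apply/eqP.
  exact: (qP l).1.
have hq : (\sum_l \sum_l' H l l' * (ratr (q l) * ratr (q l'))) - h <=
    S * ((2 * Y + 1) * tau).
  rewrite /h /S mulr_suml -sumrB; apply: ler_sum => l _.
  rewrite mulr_suml -sumrB; apply: ler_sum => l' _.
  rewrite -mulrBr; apply: le_trans (ler_norm _) _; rewrite normrM ler_wpM2l//.
  set r := ratr (q l); set r' := ratr (q l').
  have h1 := (qP l).2; have h2 := (qP l').2; rewrite -/r -/r' in h1 h2.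
  clearbody r r'.
  have -> : r * r' - z l * z l' = - (z l - r) * r' + z l * - (z l' - r') by ring.
  apply: le_trans (ler_normD _ _) _; rewrite !normrM !normrN.
  have r'Y : `|r'| <= Y + 1.
    have -> : r' = z l' - (z l' - r') by ring.
    by apply: le_trans (ler_normB _ _) _; apply: lerD => //; exact: le_trans tau1.
  apply: (@le_trans _ _ (tau * (Y + 1) + Y * tau)); last by lra.
  by apply: lerD; apply: ler_pM; rewrite ?normr_ge0 ?zY.
have := Hq [ffun l => q l] qk.
under eq_bigr do under eq_bigr do rewrite !ffunE.
by lra.
Qed.

End RationalDensity.

Section Norms.
Context {R : realType}.

Lemma norm2_sqr n (x : 'cV[R]_n) : norm2 x ^+ 2 = \sum_i x i 0 ^+ 2.
Proof. by rewrite sqr_sqrtr// sumr_ge0// => i _; exact: sqr_ge0. Qed.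

Lemma norm2_mulmx_sqr m n (B : 'M[R]_(m, n)) (y : 'cV[R]_n) :
  norm2 (B *m y) ^+ 2 = \sum_l \sum_l' (\sum_i B i l * B i l') * (y l 0 * y l' 0).
Proof.
rewrite norm2_sqr.
transitivity (\sum_i \sum_l \sum_l' (B i l * B i l') * (y l 0 * y l' 0)).
  apply: eq_bigr => i _; rewrite mxE expr2 big_distrlr/=.
  by apply: eq_bigr => l _; apply: eq_bigr => l' _; ring.
rewrite exchange_big/=; apply: eq_bigr => l _; rewrite exchange_big/=.
by apply: eq_bigr => l' _; rewrite mulr_suml.
Qed.

Lemma orthogonal_isom n (A : 'M[R]_n) (y : 'cV[R]_n) :
  orthogonal_mx A -> norm2 (A *m y) ^+ 2 = norm2 y ^+ 2.
Proof.
move=> AA; rewrite norm2_mulmx_sqr norm2_sqr; apply: eq_bigr => l _.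
have AE l' : \sum_i A i l * A i l' = (l == l')%:R.
  have /matrixP/(_ l l') := AA; rewrite !mxE => <-.
  by apply: eq_bigr => i _; rewrite !mxE.
rewrite (bigD1 l)//= AE eqxx mul1r big1 ?addr0 ?expr2// => l' ll'.
by rewrite AE eq_sym (negPf ll') mul0r.
Qed.

Lemma orthogonal_col n (A : 'M[R]_n) l : orthogonal_mx A ->
  \sum_j A j l ^+ 2 = 1.
Proof.
move=> /matrixP/(_ l l); rewrite !mxE eqxx mulr1n => <-.
by apply: eq_bigr => j _; rewrite !mxE expr2.
Qed.

Lemma abs_le_max_entry n (A : 'M[R]_n) i j : `|A i j| <= max_entry A.
Proof. exact: (le_bigmax 0 (fun ij : 'I_n * 'I_n => `|A ij.1 ij.2|) (i, j)). Qed.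

End Norms.

Section EventMeasurable.
Context {R : realType} {d : measure_display} {Omega : measurableType d}.

(** Rational vectors rarely have norm 1, but the two inequalities are homogeneous: a sparse rational
    vector is normalised to get into [F q], and conversely each inequality is the nonnegativity of a
    quadratic form, tested on sparse rational vectors. The intersection becomes countable. *)
Lemma measurable_isometry_event m n k (A : 'M[R]_n) (eps : R)
    (Phi : Omega -> 'M[R]_(m, n)) :
  (forall i j, measurable_fun setT (fun w => Phi w i j)) ->
  measurable [set w | forall x : 'cV[R]_n,
    [set A *m y | y in sparse_sphere n k] x ->
    ((1 - eps) * norm2 x ^+ 2 <= norm2 (Phi w *m x) ^+ 2
       <= (1 + eps) * norm2 x ^+ 2)%R].
Proof.
move=> mPhi.
pose yq (q : {ffun 'I_n -> rat}) : 'cV[R]_n := \col_l ratr (q l).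
pose F (q : {ffun 'I_n -> rat}) : set Omega :=
  if (#|[set l | (q l != 0)%R]%SET| <= k)%N then
  [set w | norm2 (Phi w *m (A *m yq q)) ^+ 2 \in
    `[(1 - eps) * norm2 (A *m yq q) ^+ 2, (1 + eps) * norm2 (A *m yq q) ^+ 2]]
  else setT.
have mF q : measurable (F q).
  rewrite /F; case: ifP => // _.
  have mf : measurable_fun setT (fun w => norm2 (Phi w *m (A *m yq q)) ^+ 2).
    rewrite (_ : (fun w => _) = (fun w => \sum_i
        (\sum_j Phi w i j * (A *m yq q) j 0) ^+ 2)); last first.
      apply/funext => w; rewrite norm2_sqr; apply: eq_bigr => i _.
      by rewrite mxE.
    apply: measurable_sum => i; apply: measurable_funX.
    apply: measurable_sum => j.
    by apply: measurable_funM; [exact: mPhi|exact: measurable_cst].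
  rewrite -[X in measurable X]setTI.
  exact: (mf measurableT _ (measurable_itv `[_, _])).
suff -> : [set w | forall x : 'cV[R]_n,
    [set A *m y | y in sparse_sphere n k] x ->
    ((1 - eps) * norm2 x ^+ 2 <= norm2 (Phi w *m x) ^+ 2
       <= (1 + eps) * norm2 x ^+ 2)%R] = \bigcap_q F q.
  rewrite -[X in measurable X]setCK setC_bigcap; apply: measurableC.
  apply: countable_bigcupT_measurable => [|q]; first exact: countableP.
  exact: measurableC.
apply/seteqP; split => w /= hw.
  move=> q _; rewrite /F; case: ifP => // qk /=; rewrite in_itv/=.
  pose r := norm2 (yq q).
  have r0 : 0 <= r by exact: sqrtr_ge0.
  have [r_eq0|r_neq0] := eqVneq r 0.
    have yq0 : yq q = 0.
      apply/matrixP => l o; rewrite ord1 mxE [in RHS]mxE; apply/eqP.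
      have : r ^+ 2 = 0 by rewrite r_eq0 expr0n.
      rewrite norm2_sqr => /eqP; rewrite psumr_eq0; last by move=> *; exact: sqr_ge0.
      by move=> /allP/(_ l (mem_index_enum _)); rewrite sqrf_eq0 mxE.
    rewrite yq0 !mulmx0 norm2_sqr big1 => [|i _]; last by rewrite mxE expr0n.
    rewrite norm2_sqr big1 => [|i _]; last by rewrite mxE expr0n.
    by rewrite !mulr0 lexx.
  have rgt0 : 0 < r by rewrite lt_neqAle eq_sym r_neq0.
  have scale m' (B : 'M[R]_(m', n)) : norm2 (B *m yq q) ^+ 2 =
      r ^+ 2 * norm2 (B *m (r^-1 *: yq q)) ^+ 2.
    rewrite (norm2_sqr (B *m yq q)) (norm2_sqr (B *m (r^-1 *: yq q))) mulr_sumr.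
    apply: eq_bigr => i _.
    have -> : (B *m (r^-1 *: yq q)) i 0 = r^-1 * (B *m yq q) i 0.
      by rewrite -scalemxAr mxE.
    by rewrite -exprMn mulrA mulfV// mul1r.
  have hx : [set A *m y | y in sparse_sphere n k] (A *m (r^-1 *: yq q)).
    exists (r^-1 *: yq q) => //; split.
      rewrite /norm2 (_ : \sum_i _ = 1) ?sqrtr1//.
      rewrite -norm2_sqr -[r^-1 *: _]mul1mx.
      apply: (mulfI (x := r ^+ 2)); first by rewrite sqrf_eq0.
      by rewrite -scale mul1mx mulr1.
    apply: leq_trans qk; apply/subset_leq_card/fintype.subsetP => l.
    rewrite !finset.in_set !mxE; apply: contra => /eqP ->.
    by rewrite rmorph0 mulr0.
  have := hw _ hx; rewrite !mulmxA !scale ![_ * (r ^+ 2 * _)]mulrCA.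
  by rewrite !ler_pM2l ?exprn_gt0.
move=> _ [y [y1 yk] <-].
have expand (a b : R) (v : 'cV[R]_n) :
    a * norm2 (Phi w *m (A *m v)) ^+ 2 + b * norm2 (A *m v) ^+ 2 =
    \sum_l \sum_l' (a * (\sum_i (Phi w *m A) i l * (Phi w *m A) i l') +
       b * (\sum_i A i l * A i l')) * (v l 0 * v l' 0).
  rewrite mulmxA !norm2_mulmx_sqr !mulr_sumr -big_split; apply: eq_bigr => l _.
  rewrite /= !mulr_sumr -big_split; apply: eq_bigr => l' _ /=.
  by rewrite mulrDl !mulrA.
have Fq (q : {ffun 'I_n -> rat}) : (#|[set l | (q l != 0)%R]%SET| <= k)%N ->
    (1 - eps) * norm2 (A *m yq q) ^+ 2 <= norm2 (Phi w *m (A *m yq q)) ^+ 2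
    <= (1 + eps) * norm2 (A *m yq q) ^+ 2.
  by move=> qk; have := hw q I; rewrite /F qk/= in_itv.
have pos (a b : R) : (forall q : {ffun 'I_n -> rat},
      (#|[set l | (q l != 0)%R]%SET| <= k)%N ->
      0 <= a * norm2 (Phi w *m (A *m yq q)) ^+ 2 + b * norm2 (A *m yq q) ^+ 2) ->
    0 <= a * norm2 (Phi w *m (A *m y)) ^+ 2 + b * norm2 (A *m y) ^+ 2.
  move=> hq; rewrite expand.
  apply: (quadratic_form_rational_ge0 (k := k) (z := fun l => y l 0)) => //.
  move=> q qk; have := hq q qk; rewrite expand.
  by under eq_bigr do under eq_bigr do rewrite !mxE.
apply/andP; split.
  have h : 0 <= 1 * norm2 (Phi w *m (A *m y)) ^+ 2 +
      - (1 - eps) * norm2 (A *m y) ^+ 2.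
    by apply: pos => q qk; have /andP[h _] := Fq q qk; lra.
  lra.
have h : 0 <= -1 * norm2 (Phi w *m (A *m y)) ^+ 2 + (1 + eps) * norm2 (A *m y) ^+ 2.
  by apply: pos => q qk; have /andP[_ h] := Fq q qk; lra.
lra.
Qed.

End EventMeasurable.

(** * Numerical constants and conclusion *)

(** Used with a = ln n, u = ln m, g1 = l / s, g2 = k / m. The chaining estimate involves a^3; higher
    powers are traded for powers of 2 through 2 a >= 1 and 2 u >= 1. With v >= 384 absorbing the
    first term, the total is at most v (416 x1 + 288 x2), within the 1024 allowed. *)
Lemma final_bound (R : realType) (a u g1 g2 e2 v : R) :
  2^-1 <= a -> 2^-1 <= u -> 0 <= g1 -> 0 <= g2 -> 384 <= v ->
  1024 * v * (a ^+ 7 * u * g1) <= e2 -> 1024 * v * (a ^+ 8 * u * g2) <= e2 ->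
  a ^+ 2 * (384 * a * g1 + 3 * v * a * u * (3 * g2 + 8 * g1)) <= e2.
Proof.
move=> a2 u2 g10 g20 v384; set x1 := a ^+ 7 * u * g1; set x2 := a ^+ 8 * u * g2.
move=> h1 h2.
have a0 : 0 < a by lra.
have u0 : 0 < u by lra.
have pow k : 1 <= (2 * a) ^+ k by rewrite exprn_ege1//; lra.
have i1 : a ^+ 3 * g1 <= 32 * x1.
  have -> : 32 * x1 = ((2 * a) ^+ 4 * (2 * u)) * (a ^+ 3 * g1).
    by rewrite /x1 exprMn; ring.
  rewrite ler_peMl ?mulr_ge0 ?exprn_ge0 ?(ltW a0)//.
  rewrite -[leLHS]mulr1 ler_pM// ?pow//; lra.
have i2 : a ^+ 3 * u * g2 <= 32 * x2.
  have -> : 32 * x2 = (2 * a) ^+ 5 * (a ^+ 3 * u * g2).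
    by rewrite /x2 exprMn; ring.
  by rewrite ler_peMl ?pow// mulr_ge0// mulr_ge0 ?(ltW u0)// exprn_ge0// ltW.
have i3 : a ^+ 3 * u * g1 <= 16 * x1.
  have -> : 16 * x1 = (2 * a) ^+ 4 * (a ^+ 3 * u * g1).
    by rewrite /x1 exprMn; ring.
  by rewrite ler_peMl ?pow// mulr_ge0// mulr_ge0 ?(ltW u0)// exprn_ge0// ltW.
have x10 : 0 <= x1.
  by rewrite /x1 mulr_ge0// mulr_ge0 ?(ltW u0)// exprn_ge0// ltW.
have x20 : 0 <= x2.
  by rewrite /x2 mulr_ge0// mulr_ge0 ?(ltW u0)// exprn_ge0// ltW.
have -> : a ^+ 2 * (384 * a * g1 + 3 * v * a * u * (3 * g2 + 8 * g1)) =
   384 * (a ^+ 3 * g1) + v * (9 * (a ^+ 3 * u * g2) + 24 * (a ^+ 3 * u * g1)).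
  ring.
have j1 : 384 * (a ^+ 3 * g1) <= v * (32 * x1).
  by apply: ler_pM => //; rewrite mulr_ge0// exprn_ge0// ltW.
have j2 : v * (9 * (a ^+ 3 * u * g2) + 24 * (a ^+ 3 * u * g1)) <=
    v * (288 * x2 + 384 * x1).
  by rewrite ler_wpM2l//; lra.
have vx1 : 0 <= v * x1 by rewrite mulr_ge0//; lra.
have vx2 : 0 <= v * x2 by rewrite mulr_ge0//; lra.
have {}h1 : 1024 * (v * x1) <= e2 by rewrite mulrA.
have {}h2 : 1024 * (v * x2) <= e2 by rewrite mulrA.
lra.
Qed.

(** A single column has no off-diagonal terms. This settles n = 1, where ln n = 0 empties the size
    conditions. *)
Lemma chaos_dim1 (R : realType) (m s : nat) (d : 'I_m -> 'I_1 -> bool) b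
    (x : 'I_1 -> R) : (0 < s)%N -> (forall j, (\sum_i d i j)%N = s) ->
  chaos s d b x = 0.
Proof.
move=> s0 dcol; rewrite /chaos -(sum_rownorm s0 dcol) -sumrB big1// => i _.
rewrite /psi /rownorm !big_ord1 ffunE mul1r !exprMn invsqrt_sqr sg_sqr mul1r.
by case: (d i ord0); rewrite ?expr1n ?subrr// expr0n subrr.
Qed.

Lemma norm2_sjlt (R : realType) (d : measure_display) (Omega : measurableType d)
    (P : probability Omega R) (m n s : nat)
    (sigma delta : 'I_m -> 'I_n -> {RV P >-> R}) (Phi : Omega -> 'M[R]_(m, n))
    w b c (x : 'cV[R]_n) :
  Phi w = \matrix_(i, j) ((Num.sqrt s%:R)^-1 * sigma i j w * delta i j w) ->
  sign_event sigma b w -> config_event delta c w ->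
  norm2 (Phi w *m x) ^+ 2 =
    chaos s (fun i j => c j i) b (fun j => x j 0) + norm2 x ^+ 2.
Proof.
move=> PhiE bw cw; rewrite !norm2_sqr -sum_psi_sqr; apply: eq_bigr => i _.
congr (_ ^+ 2); rewrite mxE /psi mulr_sumr; apply: eq_bigr => j _.
rewrite PhiE mxE ffunE; have /= -> := bw (i, j) I.
by have /= -> := cw j I i I; ring.
Qed.

Lemma sjlt_event_lower (R : realType) (d : measure_display)
    (Omega : measurableType d) (P : probability Omega R) (E : set Omega) (eta : R) :
  measurable E -> (P (~` E) <= eta%:E)%E -> ((1 - eta)%:E <= P E)%E.
Proof.
move=> mE; rewrite probability_setC//.
have : P E \is a fin_num by exact: fin_num_measure.
by case: (P E) => // r _; rewrite -EFinB !lee_fin => h; lra.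
Qed.

Section Sampling.
Context {R : realType} {d : measure_display} {Omega : measurableType d}.
Variables (P : probability Omega R) (m n k s : nat).
Variables (sigma delta : 'I_m -> 'I_n -> {RV P >-> R}).
Variables (Phi : Omega -> 'M[R]_(m, n)) (A : 'M[R]_n) (eps : R).

Definition isometry_event : set Omega := [set w | forall x : 'cV[R]_n,
  [set A *m y | y in sparse_sphere n k] x ->
  ((1 - eps) * norm2 x ^+ 2 <= norm2 (Phi w *m x) ^+ 2
     <= (1 + eps) * norm2 x ^+ 2)%R].

Hypotheses (sj : sjlt_data s sigma delta)
  (PhiE : forall w, Phi w =
     \matrix_(i, j) ((Num.sqrt s%:R)^-1 * sigma i j w * delta i j w))
  (AO : orthogonal_mx A).

Lemma measurable_isometry_event_sjlt : measurable isometry_event.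
Proof.
apply: measurable_isometry_event => i j.
rewrite (_ : (fun w => _) = (fun w =>
  (Num.sqrt s%:R)^-1 * sigma i j w * delta i j w)); last first.
  by apply/funext => w; rewrite PhiE mxE.
apply: measurable_funM; last exact: measurable_funP.
by apply: measurable_funM; [exact: measurable_cst|exact: measurable_funP].
Qed.

Lemma usparse_sphere (y : 'cV[R]_n) :
  sparse_sphere n k y -> usparse k (fun l => y l 0).
Proof. by move=> [y1 yk]; split=> //; rewrite -norm2_sqr y1 expr1n. Qed.

Lemma isometry_event_chaos w b c :
  ~ isometry_event w -> sign_event sigma b w -> config_event delta c w ->
  exists2 z : 'I_n -> R, usparse k z &
    eps < `|chaos s (fun i j => c j i) b (fun j => \sum_l A j l * z l)|.
Proof.
move=> nw bw cw; apply: contrapT => nz; apply: nw => _ [y yk <-].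
rewrite (norm2_sjlt _ (PhiE w) bw cw) orthogonal_isom// yk.1 expr1n !mulr1.
have -> : (fun j => (A *m y) j 0) = (fun j => \sum_l A j l * y l 0).
  by apply/funext => j; rewrite mxE.
have : `|chaos s (fun i j => c j i) b (fun j => \sum_l A j l * y l 0)| <= eps.
  rewrite leNgt; apply/negP => h; apply: nz; exists (fun l => y l 0) => //.
  exact: usparse_sphere.
by rewrite ler_norml => /andP[h1 h2]; apply/andP; split; lra.
Qed.

End Sampling.

Lemma ln_natX_le (R : realType) (x : R) (k : nat) (y : R) :
  0 < x -> 0 < y -> y <= x ^+ k -> ln y <= k%:R * ln x.
Proof.
move=> x0 y0 yx; rewrite mulr_natl -lnXn// ler_ln ?posrE//.
exact: exprn_gt0.
Qed.

(** The prefactor c K is at most 18 c a, whose square brings (c * 18)^2 into the constants. The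
    number 384 is 32 * 12, from p <= 12 a l, and W * 4 = 3 v reflects ln (5 n) <= 4 a. *)
Lemma small_condition (R : realType) (a u l l5 kV kk mm ss pp K eps c v W : R) :
  2^-1 <= a -> 2^-1 <= u -> 0 <= l -> 0 <= l5 <= 4 * a ->
  0 <= kV <= 3 * (kk / mm) + 8 * (l / ss) -> 0 < ss -> 0 < mm -> 0 <= kk ->
  0 <= pp <= 12 * a * l -> 0 <= K <= 18 * a -> 0 < eps ->
  0 < c -> 384 <= v -> W * 4 = 3 * v ->
  (c * 18) ^+ 2 * (1024 * v) * (kk * a ^+ 8 * u / eps ^+ 2) <= mm ->
  (c * 18) ^+ 2 * (1024 * v) * (a ^+ 7 * u * l / eps ^+ 2) <= ss ->
  c * K * Num.sqrt (32 * pp / ss + W * kV * u * l5) <= eps.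
Proof.
move=> a2 u2 l0 /andP[l50 l54] /andP[kV0 kVle] ss0 mm0 kk0 /andP[pp0 ppl].
move=> /andP[K0 Ka] eps0 c0 v384 Wv hm hs.
have a0 : 0 < a by clear - a2; lra.
have u0 : 0 < u by clear - u2; lra.
have v0 : 0 < v by clear - v384; lra.
pose g1 := l / ss; pose g2 := kk / mm.
have g10 : 0 <= g1 by rewrite divr_ge0// ltW.
have g20 : 0 <= g2 by rewrite divr_ge0// ltW.
pose B := c * 18; have B0 : 0 < B by rewrite mulr_gt0.
rewrite -/B in hm hs.
have h1 : 1024 * v * (a ^+ 7 * u * g1) <= (eps / B) ^+ 2.
  have -> : 1024 * v * (a ^+ 7 * u * g1) =
      (B ^+ 2 * (1024 * v) * (a ^+ 7 * u * l / eps ^+ 2)) * ((eps / B) ^+ 2 / ss).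
    by rewrite /g1; field; rewrite !gt_eqF.
  apply: le_trans (ler_wpM2r _ hs) _; first by rewrite divr_ge0 ?sqr_ge0 ?(ltW ss0).
  by rewrite mulrC mulfVK// gt_eqF.
have h2 : 1024 * v * (a ^+ 8 * u * g2) <= (eps / B) ^+ 2.
  have -> : 1024 * v * (a ^+ 8 * u * g2) =
      (B ^+ 2 * (1024 * v) * (kk * a ^+ 8 * u / eps ^+ 2)) * ((eps / B) ^+ 2 / mm).
    by rewrite /g2; field; rewrite !gt_eqF.
  apply: le_trans (ler_wpM2r _ hm) _; first by rewrite divr_ge0 ?sqr_ge0 ?(ltW mm0).
  by rewrite mulrC mulfVK// gt_eqF.
have fb := final_bound a2 u2 g10 g20 v384 h1 h2.
set X := 32 * pp / ss + _.
have XX : X <= 384 * a * g1 + 3 * v * a * u * (3 * g2 + 8 * g1).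
  apply: lerD.
    have -> : 384 * a * g1 = 32 * (12 * a * l) / ss by rewrite /g1; ring.
    by rewrite ler_wpM2r ?invr_ge0 ?(ltW ss0)// ler_wpM2l.
  have W0 : 0 <= W by clear - Wv v0; lra.
  have -> : 3 * v * a * u * (3 * g2 + 8 * g1) = W * (3 * g2 + 8 * g1) * u * (4 * a).
    by rewrite -Wv; ring.
  by rewrite ler_pM ?mulr_ge0 ?(ltW u0)// ler_wpM2r ?(ltW u0)// ler_wpM2l.
pose y := eps / (B * a).
have y0 : 0 < y by rewrite divr_gt0// mulr_gt0.
have Xy : X <= y ^+ 2.
  have -> : y ^+ 2 = (eps / B) ^+ 2 / a ^+ 2 by rewrite /y; field; rewrite !gt_eqF.
  rewrite ler_pdivlMr ?exprn_gt0// mulrC; apply: le_trans fb.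
  by rewrite ler_wpM2l ?sqr_ge0.
have sX : Num.sqrt X <= y.
  by rewrite -[leRHS]ger0_norm ?(ltW y0)// -sqrtr_sqr ler_wsqrtr.
have -> : eps = c * (18 * a) * y by rewrite /y /B; field; rewrite !gt_eqF.
by rewrite ler_pM ?mulr_ge0 ?sqrtr_ge0 ?(ltW c0)// ler_wpM2l// ltW.
Qed.

(** Bounds the number of pieces in the chain. From 2^T <= k <= 2 n and ln 2 >= 1/2 follows T <= 1 +
    2 ln n, so 2 T + 5 <= 7 + 4 ln n, and ln n >= 1/2 absorbs the 7. *)
Lemma trunc_log_le (R : realType) (n k : nat) : (1 < n)%N -> (0 < k)%N ->
  (k <= 2 * n)%N ->
  ((trunc_log 2 k).+2 * 2 + 1)%:R <= 18 * ln n%:R :> R.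
Proof.
move=> n1 k0 kn; set T := trunc_log 2 k.
have a2 : 2^-1 <= ln n%:R :> R by rewrite ln_ge_half// ler_nat.
have l2 : 2^-1 <= ln 2 :> R by exact: ln_ge_half.
have h : T%:R * ln 2 <= ln 2 + ln n%:R :> R.
  rewrite -lnM ?posrE ?ltr0n ?(ltnW n1)// mulr_natl -lnXn//.
  rewrite ler_ln ?posrE ?exprn_gt0// ?mulr_gt0 ?ltr0n ?(ltnW n1)//.
  by rewrite -natrX -natrM ler_nat (leq_trans _ kn)// trunc_logP.
have T0 : 0 <= T%:R :> R by [].
have Tle : T%:R <= 1 + 2 * ln n%:R :> R.
  rewrite leNgt; apply/negP => h2; clear - h h2 l2 a2; nra.
rewrite natrD natrM -[T.+2%:R]natr1 -[T.+1%:R]natr1.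
clear - Tle a2; lra.
Qed.

(* The inverse in the bound on [max_entry A] is taken in the extended reals,
   where 0^-1 = +oo. *)
Theorem theorem5p4 (R : realType) :
  exists C : R, 0 < C /\
  forall (n k m s : nat) (eps eta : R) (A : 'M[R]_n)
         (d : measure_display) (Omega : measurableType d)
         (P : probability Omega R) (Phi : Omega -> 'M[R]_(m, n)),
    (1 < m)%N ->
    orthogonal_mx A ->
    0 < eps < 2^-1 ->
    0 < eta <= m%:R^-1 ->
    is_sjlt P s Phi ->
    ((max_entry A)%:E < ((Num.sqrt (k%:R * ln n%:R))%:E)^-1)%E ->
    C * (k%:R * ln n%:R ^+ 8 * ln m%:R / eps ^+ 2) <= m%:R ->
    C * (ln n%:R ^+ 7 * ln m%:R * ln eta^-1 / eps ^+ 2) <= s%:R ->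
    ((1 - eta)%:E <=
      P [set w | forall x : 'cV[R]_n,
           [set A *m y | y in sparse_sphere n k] x ->
           ((1 - eps) * norm2 x ^+ 2 <= norm2 (Phi w *m x) ^+ 2
              <= (1 + eps) * norm2 x ^+ 2)%R])%E.
Proof.
have v0 : 384 <= 32 * 512 * 4 :> R by lra.
(* Here 144 is the factor in [chaos_tail], 18 comes from the number of scales, 1024 from
   [final_bound], and 32 * 512 * 4 is v, fixed by W = 96 * 512. *)
exists ((144 * 18) ^+ 2 * (1024 * (32 * 512 * 4))); split.
  rewrite mulr_gt0 ?exprn_gt0 ?mulr_gt0 ?ltr0n//; clear - v0; lra.
move=> n k m s eps eta A d Omega P Phi m1 AO /andP[eps0 eps2] /andP[eta0 etam].
move=> [sigma [delta [sj PhiE]]] Amax hm hs.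
apply: sjlt_event_lower; first exact: (measurable_isometry_event_sjlt k A eps PhiE).
rewrite -/(isometry_event k Phi A eps).
have mE : measurable (~` isometry_event k Phi A eps).
  by apply: measurableC; exact: (measurable_isometry_event_sjlt k A eps PhiE).
have s0 := sjlt_s_gt0 sj.
(* Serves n <= 1 and k = 0: either the single column creates no deviation, or there is no sparse
   unit vector at all. *)
have zero_case : (forall b (c : {ffun 'I_n -> {ffun 'I_m -> bool}}) z,
    (forall j, (\sum_i c j i)%N = s) -> usparse k z ->
    chaos s (fun i j => c j i) b (fun j => \sum_l A j l * z l) = 0) ->
    (P (~` isometry_event k Phi A eps) <= eta%:E)%E.
  move=> ch0; apply: (@le_trans _ _ (0 + 0)%:E); last by rewrite addr0 lee_fin ltW.
  apply: (prob_le_configurations sj (bad := fun _ _ => false) (W := pred0)) => //.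
  - move=> w b c Ew bw cw cs; exfalso.
    have [z zk] := isometry_event_chaos PhiE AO Ew bw cw.
    by rewrite ch0// normr0 ltNge ltW.
  - by move=> c _ _; rewrite mulr0 (_ : [set b | false]%SET = finset.set0) ?cards0.
  - by rewrite big_pred0.
have [n1|n1] := leqP n 1.
  apply: zero_case => b c z cs zk; move: n1; rewrite leq_eqVlt ltnS leqn0.
  case/orP=> /eqP n1.
    move: A z c b zk cs {sj PhiE Phi AO Amax hm hs mE sigma delta}.
    by rewrite n1 => *; apply: chaos_dim1.
  exfalso; case: zk => + _; rewrite big1 => [/eqP|[l ln0]].
    by rewrite eq_sym oner_eq0.
  by exfalso; rewrite n1 in ln0.
have [k0|k0] := posnP k.
  apply: zero_case => b c z cs [z1 zk]; exfalso.
  move: zk; rewrite k0 leqn0 cards_eq0 => /eqP/setP zk.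
  move: z1; rewrite big1 => [/eqP|l _]; first by rewrite eq_sym oner_eq0.
  by have := zk l; rewrite !inE => /negbFE/eqP ->; rewrite expr0n.
clear zero_case.
have a2 : 2^-1 <= ln n%:R :> R by rewrite ln_ge_half// ler_nat.
have u2 : 2^-1 <= ln m%:R :> R by rewrite ln_ge_half// ler_nat.
have n0R : 0 < n%:R :> R by rewrite ltr0n ltnW.
have m0R : 0 < m%:R :> R by rewrite ltr0n ltnW.
have s0R : 0 < s%:R :> R by rewrite ltr0n.
have k0R : 0 < k%:R :> R by rewrite ltr0n.
have ul : ln m%:R <= ln eta^-1.
  by rewrite ler_ln ?posrE ?invr_gt0// -[leLHS]invrK lef_pV2 ?posrE ?invr_gt0.
have eta2 : eta <= 2^-1.
  by apply: le_trans etam _; rewrite lef_pV2 ?posrE// ler_nat.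
set a := ln n%:R in a2 hm hs Amax *.
set u := ln m%:R in u2 ul hm hs *.
set l := ln eta^-1 in ul hs *.
have a0 : 0 < a by clear - a2; lra.
have l2 : 2^-1 <= l by clear - u2 ul; lra.
have ka0 : 0 < k%:R * a by rewrite mulr_gt0.
have Aka i j : k%:R * a * A i j ^+ 2 <= 1.
  have r0 : 0 < Num.sqrt (k%:R * a) by rewrite sqrtr_gt0.
  have Ar : `|A i j| <= (Num.sqrt (k%:R * a))^-1.
    apply: le_trans (abs_le_max_entry A i j) _; apply: ltW.
    by move: Amax; rewrite inver gt_eqF// lte_fin.
  have : (Num.sqrt (k%:R * a) * `|A i j|) ^+ 2 <= 1.
    rewrite expr_le1// ?mulr_ge0 ?sqrtr_ge0//.
    by rewrite -[leRHS](mulfV (lt0r_neq0 r0)) ler_pM2l.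
  by rewrite exprMn sqr_sqrtr ?(ltW ka0)// real_normK ?num_real.
(* Summing [Aka] down a column, which has unit norm, gives k ln n <= n; then ln n >= 1/2. *)
have kn : (k <= 2 * n)%N.
  rewrite -(ler_nat R) natrM.
  have : k%:R * a <= n%:R.
    pose l0 : 'I_n := Ordinal (ltnW n1).
    have -> : k%:R * a = \sum_j k%:R * a * A j l0 ^+ 2.
      by rewrite -mulr_sumr orthogonal_col// mulr1.
    have -> : n%:R = \sum_(j < n) 1 :> R by rewrite sumr_const card_ord.
    by apply: ler_sum => j _; exact: Aka.
  by clear - a2 k0R; nra.
have l5a : ln (5 * n)%:R <= 4 * a.
  apply: (@ln_natX_le R n%:R 4) => //; first by rewrite ltr0n muln_gt0 /= ltnW.
  rewrite -natrX ler_nat expnSr leq_mul2r; apply/orP; right.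
  by apply: (@leq_trans (2 ^ 3)%N) => //; rewrite leq_exp2r.
have l50 : 0 <= ln (5 * n)%:R :> R.
  by rewrite ln_ge0// ler1n muln_gt0 /= ltnW.
(* The exponent k ln n is the largest for which coherence guarantees lam * A_ij^2 <= 1. The value of
   [big] makes the union over m n pairs (row, column of A) cost eta / 2, and [t] solves 3 lam s / m
   - lam t = - ln big. *)
pose lam := k%:R * a.
pose big : R := 2 * (m%:R * n%:R) / eta.
have big0 : 0 < big by rewrite divr_gt0// mulr_gt0// mulr_gt0.
have lnbig : 0 <= ln big <= 8 * a * l.
  have -> : ln big = ln 2 + (u + a) + l.
    rewrite /big !lnM ?posrE ?mulr_gt0 ?invr_gt0//.
  have : ln 2 <= u by rewrite ler_ln ?posrE// ler_nat.
  have : 2^-1 <= ln 2 :> R by exact: ln_ge_half.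
  by clear - ul u2 a2 l2; move=> ? ?; apply/andP; split; nra.
case/andP: lnbig => lnbig0 lnbig1.
pose t := 3 * (s%:R / m%:R) + ln big / lam.
pose V := s%:R^-1 * t.
have V0 : 0 < V.
  rewrite mulr_gt0 ?invr_gt0// ltr_pwDl//; last by rewrite divr_ge0// ltW.
  by rewrite mulr_gt0// divr_gt0.
have al0 : 0 <= 8 * a * l by rewrite mulr_ge0 ?mulr_ge0 ?(ltW a0)//; clear - l2; lra.
(* As l >= 1/2, p >= 4 a >= ln (5 n). As a >= 1/2, 2 p >= 8 l, so 12 exp (-2p) <= 12 eta^8 <= 12 eta
   / 128 <= eta / 2. The successor is absorbed in 12 a l since a l >= 1/4. *)
pose p := (Num.truncn (8 * a * l)).+1.
have p_ge : 8 * a * l <= p%:R by rewrite ltW// truncnS_gt.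
have p_le : p%:R <= 12 * a * l.
  have /andP[h _] := truncn_itv al0.
  rewrite /p -natr1; clear - h a2 l2; nra.
have etaE : eta%:E = (eta / 2 + eta / 2)%:E by congr (_%:E); field.
pose bad (b : {ffun 'I_m * 'I_n -> bool}) (c : {ffun 'I_n -> {ffun 'I_m -> bool}}) :=
  `[< exists2 z : 'I_n -> R, usparse k z &
    eps < `|chaos s (fun i j => c j i) b (fun j => \sum_l A j l * z l)| >].
pose W (c : {ffun 'I_n -> {ffun 'I_m -> bool}}) :=
  [exists i, exists l, t < \sum_j (c j i)%:R * A j l ^+ 2].
rewrite etaE; apply: (prob_le_configurations sj (bad := bad) (W := W)) => //.
- by rewrite divr_ge0// ltW.
- by move=> w b c Ew bw cw _; apply/asboolP; exact: isometry_event_chaos Ew bw cw.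
- move=> c cs nW.
  have h := @chaos_tail R m n s k (trunc_log 2 k).+1 p (fun i j => c j i)
    (fun i j => A i j) V eps.
  apply: le_trans (h _ _ _ _ _ _ _ _ _ _ _ _ _ _ _) _ => //.
  + exact: ltnW.
  + move=> z; have := orthogonal_isom (\col_l z l) AO; rewrite !norm2_sqr => zA.
    transitivity (\sum_i (A *m \col_l z l) i 0 ^+ 2).
      apply: eq_bigr => j _; rewrite mxE; congr (_ ^+ 2).
      by apply: eq_bigr => l' _; rewrite mxE.
    by rewrite zA; apply: eq_bigr => j _; rewrite mxE.
  + move=> i l'; rewrite /rownorm /V ler_wpM2l// leNgt; apply/negP => tW.
    by move/negP: nW; apply; apply/existsP; exists i; apply/existsP; exists l'.
  + by rewrite ltnW// trunc_log_ltn.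
  + by clear - l5a p_ge a0 l2; nra.
  + by clear - eps2; lra.
  + have -> : 96 * (512 * (k%:R * V) * ln m%:R) * ln (5 * n)%:R =
      96 * 512 * (k%:R * V) * u * ln (5 * n)%:R by rewrite /u; ring.
    apply: (@small_condition R a u l (ln (5 * n)%:R) (k%:R * V) k%:R m%:R s%:R
      p%:R _ eps 144 (32 * 512 * 4) (96 * 512)) => //.
    * by clear - l2; lra.
    * by rewrite l50 l5a.
    * rewrite mulr_ge0 ?(ltW V0)//=.
      have -> : k%:R * V = 3 * (k%:R / m%:R) + ln big / a / s%:R.
        by rewrite /V /t /lam; field; rewrite !gt_eqF.
      rewrite lerD2l mulrA ler_wpM2r ?invr_ge0 ?(ltW s0R)//.
      by rewrite ler_pdivrMr// mulrAC.
    * by rewrite ler0n p_le.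
    * by rewrite ler0n trunc_log_le.
    * by clear; ring.
  rewrite ler_wpM2l//.
  have e8 : expR (- (2 * p)%:R) <= eta ^+ 8.
    have -> : eta ^+ 8 = expR (- (8 * l)).
      rewrite /l lnV ?posrE// mulrN opprK expRM_natl lnK//.
    by rewrite ler_expR natrM; clear - p_ge a2 l2; nra.
  have : eta ^+ 8 <= 2^-1 ^+ 7 * eta.
    rewrite exprSr ler_wpM2r ?(ltW eta0)//; apply: lerXn2r; rewrite ?nnegrE//.
    exact: ltW.
  have -> : 2^-1 ^+ 7 = 128^-1 :> R by rewrite exprVn; congr (_^-1); ring.
  by clear - e8 eta0; lra.
apply: le_trans (@column_chernoff_union R m n (column_prob delta) (s%:R / m%:R)
   _ _ _ (fun l j => A j l ^+ 2) lam t _ _ _ _) _.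
- exact: column_prob_ge0.
- exact: sum_column_prob.
- by move=> j i; exact: (sum_column_prob_row sj).
- exact: ltW.
- by move=> *; exact: sqr_ge0.
- by move=> *; exact: Aka.
- by move=> l'; exact: orthogonal_col.
have -> : 3 * lam * (s%:R / m%:R) - lam * t = - ln big.
  by rewrite /t; field; rewrite !gt_eqF.
rewrite expRN lnK ?posrE// /big le_eqVlt; apply/orP; left; apply/eqP.
by field; rewrite !gt_eqF.
Qed.
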